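(* For each $k\in\mathbb{N}$, let $\Xi_k:=[a_1^{(k)},\ldots,a_k^{(k)}]\in\mathbb{R}^{1\times k}$ be given with $a_j^{(k)}>0$, $j=1,\ldots,k$, and let $B(\cdot|\Xi_k)$ be the box spline associated with $\Xi_k$. Assume that $$\|\Xi_k\|_2^2=\sigma^2+\epsilon_k,$$ where $\sigma\in\mathbb{R}$ is a fixed constant and $\lim_{k\to\infty}\epsilon_k=0$, and assume that $$c_1\le\frac{\max_{1\le j\le k}a_j^{(k)}}{\min_{1\le j\le k}a_j^{(k)}}\le c_2,$$ where $c_1$ and $c_2$ are fixed positive constants independent of $k$. Then $$\max_{x}\left|\sqrt{\frac{6}{\pi\sigma^2}}\exp\left(-\frac{6x^2}{\sigma^2}\right)-B(x|\Xi_k)\right|\lesssim_{c_1,c_2}\frac{(\ln k)^3}{k}+|\epsilon_k|\cdot\bigl|\ln(|\epsilon_k|)\bigr|\cdot\ln(k).$$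
   Context: Here $\|\Xi_k\|_2^2=\sum_{j=1}^k (a_j^{(k)})^2$. For $\Xi\in\mathbb{R}^{1\times n}$, the univariate box spline $B(\cdot|\Xi)$ is the distribution given by the rule $\int_{\mathbb{R}}B(x|\Xi)\varphi(x)\,dx=\int_{[-1/2,1/2)^n}\varphi(\Xi u)\,du$ for all test functions $\varphi\in\mathscr{D}(\mathbb{R})$. The notation $X\lesssim_{a,b,\ldots}Y$ means $X\le C\cdot Y$, where the constant $C$ may depend on $a,b,\ldots$ but on no other variable.
   Formalization: The bound with C depending only on c_1, c_2 is asserted for all sufficiently large k (threshold may depend on σ, Ξ_k, ε_k); for all k≥2 the constant may depend on the given data; k=1 is excluded, σ≠0 is assumed, and B(·|Ξ_k) is the continuous representative for k≥2. *)

(* Defs.v *)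
From HB Require Import structures.
From mathcomp Require Import all_boot all_order all_algebra.
From mathcomp Require Import all_classical all_reals all_analysis.
Import Order.TTheory GRing.Theory Num.Theory.
Import numFieldNormedType.Exports.

Set Implicit Arguments.
Unset Strict Implicit.
Unset Printing Implicit Defensive.

Local Open Scope classical_set_scope.
Local Open Scope ring_scope.

Definition smooth (R : realType) (phi : R -> R) : Prop :=
  forall (n : nat) (x : R), derivable (derive1n n phi) x 1.

(* The space D(R). Real-valued test functions suffice: both sides of the rule
   defining the box spline are linear in the test function. *)
Definition test_function (R : realType) (phi : R -> R) : Prop :=
  smooth phi /\ compact (closure [set x | phi x != 0]).

(* The integral of F over the half-open cube [-1/2, 1/2)^n, as n iterated
   one-dimensional Lebesgue integrals (the library has no Lebesgue measure on
   R^n). By Fubini this is the n-dimensional Lebesgue integral for bounded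
   measurable F, in particular for the continuous integrands used below. *)
Fixpoint cube_integral (R : realType) (n : nat) : ('cV[R]_n -> R) -> R :=
  match n with
  | 0 => fun F => F 0
  | n'.+1 => fun F : 'cV[R]_(1 + n') -> R =>
      \int[@lebesgue_measure R]_(t in `[- 2^-1, 2^-1[)
        cube_integral (fun u : 'cV[R]_n' => F (col_mx t%:M u))
  end.

(* The distribution phi |-> \int_([-1/2, 1/2)^n) phi (Xi u) du. *)
Definition box_spline_distribution (R : realType) (n : nat) (Xi : 'rV[R]_n)
    (phi : R -> R) : R :=
  cube_integral (fun u : 'cV[R]_n => phi ((Xi *m u) 0 0)).

(* The function B represents the box spline distribution B(.|Xi). This
   determines B up to a null set. *)
Definition is_box_spline (R : realType) (n : nat) (Xi : 'rV[R]_n)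
    (B : R -> R) : Prop :=
  locally_integrable [set: R] B /\
  forall phi : R -> R, test_function phi ->
    \int[@lebesgue_measure R]_(x in [set: R]) (B x * phi x) =
    box_spline_distribution Xi phi.

(* The seeds of the two iterated operators below are immaterial for a nonempty
   row of positive entries. *)
Definition max_entry (R : realType) (n : nat) (Xi : 'rV[R]_n) : R :=
  \big[Num.max/0]_(j < n) Xi 0 j.

Definition min_entry (R : realType) (n : nat) (Xi : 'rV[R]_n) : R :=
  \big[Num.min/max_entry Xi]_(j < n) Xi 0 j.

(* The density of the centered normal law of variance sigma^2 / 12. *)
Definition gaussian (R : realType) (sigma x : R) : R :=
  Num.sqrt (6 / (pi * sigma ^+ 2)) * expR (- (6 * x ^+ 2) / sigma ^+ 2).

(* For e = 0 the second term is 0, the limit of t * `|ln t| as t -> 0+. *)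
Definition rate (R : realType) (k : nat) (e : R) : R :=
  ln k%:R ^+ 3 / k%:R + `|e| * `|ln `|e| | * ln k%:R.

(* Main.v *)
Require Import Defs.
From HB Require Import structures.
From mathcomp Require Import all_boot all_order all_algebra.
From mathcomp Require Import all_classical all_reals all_analysis.
From mathcomp Require Import measurable_realfun zify ring lra.
Import Order.TTheory GRing.Theory Num.Theory.
Import numFieldNormedType.Exports.

Set Implicit Arguments.
Unset Strict Implicit.
Unset Printing Implicit Defensive.

Local Open Scope classical_set_scope.
Local Open Scope ring_scope.

(** The symbol (Fourier transform) of [B(.|Xi)] is [prod_j sinc (a_j t / 2)],
    that of the normal law of variance [v = sigma^2 / 12] is [exp (- v t^2 / 2)].  Factor by factor
    [|sinc x - exp (- x^2 / 6)| <= x^4 / 72], and both factors are at most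
    [(1 + x^2 / 6)^(-1/2)].  Since the [a_j] are comparable, telescoping the
    product bounds the difference of the symbols by a multiple of
    [(1 / k + |eps_k|) / (1 + t^2)], whose integral bounds the difference of the
    densities.  The constants depend on [sigma], but the logarithms of the rate
    tend to infinity and absorb them, so that [C = 1] works for large [k].

    The box spline is known only through test functions.  A bump function [phi]
    is mollified by the heat kernel of variance [s], whose symbol is integrable
    and for which the mean over the cube is computed by Fubini; [s] then tends
    to 0, and continuity of [B] localises the comparison to a point. *)

(** A single [sinc] factor decays only like [1 / |t|], whereas the Taylor remainder grows like
    [t^4]. The factors left over by the telescoping must therefore supply enough decay to absorb the
    remainder and still leave something integrable. The [n] remainders, each of order [a^4], add up
    to order [1 / n] because comparable entries and a nearly fixed norm force [n a^2] to be of the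
    order of [sigma^2]. The telescoping is done against the Gaussian with the exact variance of the
    box spline; [eps_k] enters only when that variance is replaced by its limit.

    Fourier inversion is never invoked. The heat kernel is by construction a cosine integral, which
    a differential equation evaluates, and averaging acts on [cos (t z)] as multiplication by
    [sinc]. All symbols are even, so real cosine integrals suffice.

    The large values of [k] leave finitely many [k >= 2]. For these a finite bound without any rate
    is enough, and two factors already make the symbol integrable. *)

Local Notation mu := lebesgue_measure.

(** * Integration *)

Section Integrals.
Context {R : realType}.
Implicit Types (D : set R) (f g h : R -> R).

Lemma derivable_continuous f : (forall x, derivable f x 1) -> continuous f.
Proof. by move=> df x; apply: differentiable_continuous; exact/derivable1_diffP. Qed.

Lemma continuous_funM f g : continuous f -> continuous g ->
  continuous (fun x => f x * g x).
Proof. by move=> cf cg x; apply: continuousM; [exact: cf|exact: cg]. Qed.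

Lemma continuous_funB f g : continuous f -> continuous g ->
  continuous (fun x => f x - g x).
Proof. by move=> cf cg x; apply: (@continuousB _ R^o); [exact: cf|exact: cg]. Qed.

Lemma continuous_fun_comp f g : continuous f -> continuous g ->
  continuous (fun x => f (g x)).
Proof. by move=> cf cg x; apply: continuous_comp; [exact: cg|exact: cf]. Qed.

Lemma dominated_integrable D f g : measurable D -> measurable_fun D f ->
  mu.-integrable D (EFin \o g) -> (forall x, D x -> `|f x| <= g x) ->
  mu.-integrable D (EFin \o f).
Proof.
move=> mD mf ig fg; apply: le_integrable ig => //; first exact/measurable_EFinP.
by move=> x Dx; rewrite /= lee_fin (le_trans (fg x Dx))// ler_norm.
Qed.

Lemma le_norm_Rintegral D f g : measurable D -> measurable_fun D f ->
  mu.-integrable D (EFin \o g) -> (forall x, D x -> `|f x| <= g x) ->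
  `|\int[mu]_(x in D) f x| <= \int[mu]_(x in D) g x.
Proof.
move=> mD mf ig fg; have if_ := dominated_integrable mD mf ig fg.
have /le_trans := @le_normr_Rintegral _ (measurableTypeR R) R mu _ _ mD if_; apply.
apply: le_Rintegral => //.
exact: (integrable_norm if_).
Qed.

Lemma integrable_continuous_segment (a b : R) f : continuous f ->
  mu.-integrable `[a, b] (EFin \o f).
Proof.
move=> cf; apply: continuous_compact_integrable; first exact: segment_compact.
exact: continuous_subspaceT.
Qed.

Lemma integrable_continuous_itv_co (a b : R) f : continuous f ->
  mu.-integrable `[a, b[ (EFin \o f).
Proof.
move=> cf; apply: integrableS (integrable_continuous_segment a b cf) => //.
exact: subset_itv_co_cc.
Qed.

Lemma integrable_oneDsqrV :
  mu.-integrable [set: R] (EFin \o (fun t : R => (1 + t ^+ 2)^-1)).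
Proof.
have ge0 (t : R) : 0 <= (1 + t ^+ 2)^-1 by rewrite invr_ge0 addr_ge0 ?sqr_ge0.
have c : continuous (fun t : R => (1 + t ^+ 2)^-1) := @continuous_oneDsqrV R.
apply/integrableP; split.
  by apply/measurable_EFinP; exact: continuous_measurable_fun.
under eq_integral do rewrite /= ger0_norm//.
rewrite ge0_symfun_integralT//; last by move=> t; rewrite /= sqrrN.
rewrite (_ : [set x | _] = `[0, +oo[%classic); last first.
  by apply/seteqP; split => x/=; rewrite in_itv/= andbT.
by rewrite (@integral0y_oneDsqr R) -EFinM ltry.
Qed.

Lemma continuous_Rintegral D (f : R -> R -> R) g : measurable D ->
  mu.-integrable D (EFin \o g) ->
  (forall x, measurable_fun D (f x)) ->
  (forall x y, D y -> `|f x y| <= g y) ->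
  (forall y, D y -> continuous (f ^~ y)) ->
  continuous (fun x => \int[mu]_(y in D) f x y).
Proof.
move=> mD ig mf fg cf x.
apply: (@continuity_under_integral _ _ _ mu f D mD (x - 1) (x + 1) _ _ g) => //.
- by move=> z _; apply: dominated_integrable ig _ => // y; exact: fg.
- by apply: aeW => y Dy z _; exact: cf.
- by move=> z _; apply: aeW => y; exact: fg.
- by rewrite inE /= in_itv /=; lra.
Qed.

(** Extending the integrand by 0 reduces the claim to Fubini on the plane, and the product bound
    gives integrability there by Tonelli. In the uses below one factor is constant on the bounded
    unit interval and the other is integrable over the line. *)
Lemma Rintegral_swap D1 D2 (f : R * R -> R) g h :
  measurable D1 -> measurable D2 -> measurable_fun setT f ->
  mu.-integrable D1 (EFin \o g) -> mu.-integrable D2 (EFin \o h) ->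
  (forall x y, D1 x -> D2 y -> `|f (x, y)| <= g x * h y) ->
  \int[mu]_(x in D1) \int[mu]_(y in D2) f (x, y) =
  \int[mu]_(y in D2) \int[mu]_(x in D1) f (x, y).
Proof.
move=> mD1 mD2 mf ig ih fgh.
pose g' := g \_ D1; pose h' := h \_ D2.
have ig' : mu.-integrable setT (EFin \o g').
  rewrite /g' -restrict_EFin; apply/integrable_restrict => //.
  by rewrite setTI.
have ih' : mu.-integrable setT (EFin \o h').
  rewrite /h' -restrict_EFin; apply/integrable_restrict => //.
  by rewrite setTI.
pose F := fun z : R * R => \1_D1 z.1 * \1_D2 z.2 * f z.
have mF0 : measurable_fun setT F.
  apply: measurable_funM => //.
  apply: measurable_funM.
    exact: (measurableT_comp (measurable_indic mD1) measurable_fst).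
  exact: (measurableT_comp (measurable_indic mD2) measurable_snd).
have mF : measurable_fun setT (EFin \o F) by exact/measurable_EFinP.
have mFx x : measurable_fun setT (fun y : R => F (x, y)).
  exact: (measurableT_comp mF0 (pair1_measurable x)).
have mfx x : measurable_fun setT (fun y : R => f (x, y)).
  exact: (measurableT_comp mf (pair1_measurable x)).
have mfy y : measurable_fun setT (fun x : R => f (x, y)).
  exact: (measurableT_comp mf (pair2_measurable y)).
have Fgh x y : `|F (x, y)| <= `|g' x| * `|h' y|.
  rewrite /F /g' /h' /= !indicE !patchE.
  case: (boolP (x \in D1)) => /= [/set_mem D1x|_]; last by rewrite !mul0r normr0 mulr_ge0.
  case: (boolP (y \in D2)) => /= [/set_mem D2y|_]; last by rewrite mulr0 mul0r normr0 mulr_ge0.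
  by rewrite !mul1r (le_trans (fgh _ _ D1x D2y))// -normrM ler_norm.
have mh' := measurable_int _ (integrable_norm ih').
have fin1 := integrable_fin_num measurableT (integrable_norm ig').
have fin2 := integrable_fin_num measurableT (integrable_norm ih').
have iF : (lebesgue_measure \x lebesgue_measure)%E.-integrable setT (EFin \o F).
  apply: ((@integrable12ltyP _ _ (measurableTypeR R) (measurableTypeR R) R mu mu _ mF).2).
  pose H := \int[mu]_y `|h' y|.
  apply: (@le_lt_trans _ _ (\int[mu]_x (`|g' x| * H)%:E)%E).
    apply: ge0_le_integral => //.
    - by move=> x _; exact: integral_ge0.
    - apply: (@measurable_fun_fubini_tonelli_F _ _ (measurableTypeR R)
        (measurableTypeR R) R mu (abse \o (EFin \o F))) => //.
        exact: measurableT_comp.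
      by move=> z; exact: abse_ge0.
    - apply/measurable_EFinP; apply: measurable_funM => //.
      apply: measurableT_comp => //.
      by apply/measurable_EFinP; exact: (measurable_int _ ig').
    - move=> x _ /=; rewrite EFinM fineK// -ge0_integralZl_EFin//.
      apply: ge0_le_integral => //.
      +  have mn : measurable_fun setT (fun y : R => `|F (x, y)|).
            by apply: measurableT_comp => //; exact: mFx.
          by apply/measurable_EFinP; exact mn.
      + apply/measurable_EFinP; apply: measurable_funM => //; apply/measurable_EFinP; exact mh'.
      + by move=> y _; rewrite -EFinM lee_fin.
  have : mu.-integrable setT (EFin \o (fun x => `|g' x| * H)).
    exact: (integrableZr _ H (integrable_norm ig')).
  by move/integrable_lty => /(_ measurableT).
have := Fubini iF.
have int2 x : D1 x -> mu.-integrable D2 (EFin \o (fun y => f (x, y))).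
  move=> D1x; apply: (@dominated_integrable _ _ (fun y => g x * h y)) => //.
  - exact: measurable_funTS.
  - exact: (integrableZl _ (g x) ih).
  - by move=> y; exact: fgh.
have int1 y : D2 y -> mu.-integrable D1 (EFin \o (fun x => f (x, y))).
  move=> D2y; apply: (@dominated_integrable _ _ (fun x => g x * h y)) => //.
  - exact: measurable_funTS.
  - exact: (integrableZr _ (h y) ig).
  - by move=> x D1x; exact: fgh.
have E1 x : (\int[mu]_y (F (x, y))%:E =
    (((fun x => \int[mu]_(y in D2) f (x, y)) \_ D1) x)%:E)%E.
  rewrite patchE /F/=; case: ifPn => [/set_mem D1x|nD1x].
    rewrite fineK; last exact: integrable_fin_num (int2 _ D1x).
    rewrite [RHS]integral_mkcond; apply: eq_integral => y _.
    rewrite restrict_EFin /= patchE !indicE mem_set// mul1r.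
    by case: ifP; rewrite ?mul1r ?mul0r.
  by rewrite integral0_eq// => y _; rewrite indicE (negbTE nD1x) !mul0r.
have E2 y : (\int[mu]_x (F (x, y))%:E =
    (((fun y => \int[mu]_(x in D1) f (x, y)) \_ D2) y)%:E)%E.
  rewrite patchE /F/=; case: ifPn => [/set_mem D2y|nD2y].
    rewrite fineK; last exact: integrable_fin_num (int1 _ D2y).
    rewrite [RHS]integral_mkcond; apply: eq_integral => x _.
    rewrite restrict_EFin /= patchE !indicE (mem_set D2y) mulr1.
    by case: ifP; rewrite ?mul1r ?mul0r.
  by rewrite integral0_eq// => x _; rewrite !indicE (negbTE nD2y) mulr0 mul0r.
move=> FE; rewrite [LHS]Rintegral_mkcond [RHS]Rintegral_mkcond /Rintegral.
congr fine; transitivity (\int[mu]_x \int[mu]_y (F (x, y))%:E)%E.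
  by apply: eq_integral => x _; rewrite E1.
by rewrite [LHS]FE; apply: eq_integral => y _; rewrite E2.
Qed.

End Integrals.

(** * The Fourier transform of a Gaussian *)

Section GaussianTransform.
Context {R : realType}.
Implicit Types (s t v x : R).

(** The integrals over [[-n, n]] equal [G n - G (- n)] and converge to the integral over the line by
    dominated convergence. This supplies integration by parts on the line. *)
Lemma Rintegral_derive_eq0 (G g : R -> R) : (forall t, is_derive t 1 G (g t)) ->
  continuous g -> mu.-integrable setT (EFin \o g) ->
  G n%:R @[n --> \oo] --> (0 : R) -> G (- n%:R) @[n --> \oo] --> (0 : R) ->
  \int[mu]_t g t = 0.
Proof.
move=> dG cg ig G0 GN0.
have mg : measurable_fun setT g by exact: continuous_measurable_fun.
pose gn (n : nat) := g \_ `[- n%:R, n%:R].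
have mgn n : @measurable_fun _ _ (measurableTypeR R) _ setT (fun t => (gn n t)%:E).
  apply/measurable_EFinP; apply/(measurable_restrictT _ _).1 => //.
  exact: measurable_funTS.
have [||| _ _] := @dominated_convergence _ (measurableTypeR R) R mu setT measurableT
    (fun n t => (gn n t)%:E) (EFin \o g) (fun t => `|g t|%:E) mgn _ _ (integrable_norm ig) _.
- by apply/measurable_EFinP; exact mg.
- apply: aeW => t _ /=; apply: cvg_EFin; first exact: nearW.
  apply: cvg_near_cst; near=> n; rewrite /gn /= patchE mem_set//= in_itv /= -ler_norml.
  by near: n; exact: nbhs_infty_ger.
- apply: aeW => t n _ /=; rewrite lee_fin /gn patchE.
  by case: ifP => //; rewrite normr0.
rewrite -(fineK (integrable_fin_num measurableT ig)) => /fine_cvgP[_] cvg1.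
have cvg2 : (G n%:R - G (- n%:R)) @[n --> \oo] --> (0 : R).
  by have := @cvgB _ R^o _ _ _ _ _ _ _ G0 GN0; rewrite subr0; apply.
suff : (fine \o (fun n => \int[mu]_x (gn n x)%:E)%E) n @[n --> \oo] --> (0 : R).
  by move=> cvg3; have := cvg_unique _ cvg1 cvg3; apply.
apply: cvg_trans cvg2; apply: near_eq_cvg; near=> n => /=.
have n0 : (0 < n%:R :> R) by near: n; exact: nbhs_infty_gtr.
rewrite -[RHS]/(\int[mu]_x (g \_ `[- n%:R, n%:R]) x) -Rintegral_mkcond /Rintegral.
rewrite (@continuous_FTC2 _ _ G)//.
- by rewrite -subr_gt0 opprK addr_gt0.
- exact: continuous_subspaceT.
- have cG : continuous G.
    move=> t; apply: differentiable_continuous; apply/derivable1_diffP.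
    by have := dG t => -[].
  split => //.
  + by apply: cvg_at_right_filter; exact: cG.
  + by apply: cvg_at_left_filter; exact: cG.
- by move=> t _; rewrite derive1E; exact: derive_val.
Unshelve. all: by end_near. Qed.

(** Two readings are used: the characteristic function of the centered normal law of variance [v],
    and the unnormalised density of the one of variance [v^-1]. *)
Definition gauss_exp v t : R := expR (- (v * t ^+ 2 / 2)).

Lemma gauss_exp_ge0 v t : 0 <= gauss_exp v t. Proof. exact: expR_ge0. Qed.

Lemma continuous_gauss_exp v : continuous (gauss_exp v).
Proof. by apply: derivable_continuous => t; exact: ex_derive. Qed.

Lemma gauss_exp_normal v t : 0 < v -> gauss_exp v t = normal_fun 0 (Num.sqrt v^-1) t.
Proof.
move=> v0; rewrite /gauss_exp /normal_fun subr0 sqr_sqrtr ?invr_ge0 ?ltW//.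
congr expR; rewrite -mulr_natr; field; lra.
Qed.

Lemma integrable_gauss_exp v : 0 < v -> mu.-integrable setT (EFin \o gauss_exp v).
Proof.
move=> v0; have s0 : Num.sqrt v^-1 != 0 by rewrite gt_eqF// sqrtr_gt0 invr_gt0.
have := integrable_normal_pdf (0 : R) (Num.sqrt v^-1).
rewrite normal_pdfE// => /(integrableZl measurableT (normal_peak (Num.sqrt v^-1))^-1).
apply: eq_integrable => // t _; rewrite /= -EFinM mulKf ?gauss_exp_normal//.
by rewrite gt_eqF ?normal_peak_gt0.
Qed.

Lemma Rintegral_gauss_exp v : 0 < v -> \int[mu]_t gauss_exp v t = Num.sqrt (2 * pi / v).
Proof.
move=> v0; have s0 : Num.sqrt v^-1 != 0 by rewrite gt_eqF// sqrtr_gt0 invr_gt0.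
have := integral_normal_pdf (0 : R) (Num.sqrt v^-1).
rewrite normal_pdfE// => /(congr1 fine)/=.
rewrite -[LHS]/(\int[mu]_t (normal_peak (Num.sqrt v^-1) *
  normal_fun 0 (Num.sqrt v^-1) t)).
under eq_Rintegral do rewrite -gauss_exp_normal//.
rewrite RintegralZl//; last exact: integrable_gauss_exp.
move=> /(canRL (mulKf _)) ->; last by rewrite gt_eqF ?normal_peak_gt0.
rewrite mulr1 invrK sqr_sqrtr ?invr_ge0 ?ltW//; congr Num.sqrt.
by rewrite -mulr_natr; field; lra.
Qed.

(** Half of the exponent pays for the factor [|t|], through [1 + x <= exp x]; the other half keeps
    the Gaussian decay. *)
Lemma norm_gauss_exp_le v t : 0 < v ->
  `|t| * gauss_exp v t <= Num.sqrt v^-1 * gauss_exp (v / 2) t.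
Proof.
move=> v0; have -> : gauss_exp v t = gauss_exp (v / 2) t * gauss_exp (v / 2) t.
  by rewrite /gauss_exp -expRD; congr expR; field.
rewrite mulrA ler_wpM2r ?gauss_exp_ge0// /gauss_exp expRN ler_pdivrMr ?expR_gt0//.
have r0 : 0 < Num.sqrt v^-1 by rewrite sqrtr_gt0 invr_gt0.
have vE : v = (Num.sqrt v^-1) ^- 2 by rewrite sqr_sqrtr ?invrK// invr_ge0 ltW.
apply: (@le_trans _ _ (Num.sqrt v^-1 * (1 + v / 2 * t ^+ 2 / 2))); last first.
  by apply: ler_wpM2l; [exact: ltW|exact: expR_ge1Dx].
rewrite {2}vE -(real_normK (num_real t)).
move: (`|t|) (Num.sqrt v^-1) r0 => u r r0.
(* With [v = r^-2] the claim is the AM-GM inequality [u <= r + u^2 / (4 r)]. *)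
have : 0 <= (r - u / 2) ^+ 2 / r by rewrite divr_ge0 ?sqr_ge0// ltW.
rewrite -subr_ge0; congr (0 <= _); field; exact: lt0r_neq0.
Qed.

Lemma integrable_norm_gauss_exp v : 0 < v ->
  mu.-integrable setT (EFin \o (fun t => `|t| * gauss_exp v t)).
Proof.
move=> v0.
apply: (@dominated_integrable _ _ _ (fun t => Num.sqrt v^-1 * gauss_exp (v / 2) t)) => //.
- apply: measurable_funM; first exact: normr_measurable.
  by have /continuous_measurable_fun := @continuous_gauss_exp v.
- by apply: (integrableZl measurableT (Num.sqrt v^-1) (integrable_gauss_exp _)); lra.
- by move=> t _; rewrite ger0_norm ?mulr_ge0 ?gauss_exp_ge0//; exact: norm_gauss_exp_le.
Qed.
Lemma integrable_sqr_gauss_exp v : 0 < v ->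
  mu.-integrable setT (EFin \o (fun t => t ^+ 2 * gauss_exp v t)).
Proof.
move=> v0; have v20 : 0 < v / 2 by lra.
apply: (dominated_integrable _ _
  (integrableZl measurableT (Num.sqrt v^-1) (integrable_norm_gauss_exp v20))) => //.
- apply: continuous_measurable_fun; apply: continuous_funM (@continuous_gauss_exp v).
  exact: exprn_continuous.
- move=> t _; rewrite (ger0_norm (mulr_ge0 (sqr_ge0 t) (gauss_exp_ge0 v t))).
  rewrite -{1}(real_normK (num_real t)) expr2 -mulrA [leRHS]mulrCA ler_wpM2l//.
  exact: norm_gauss_exp_le.
Qed.

Lemma cvg_gauss_exp0 v : 0 < v -> gauss_exp v n%:R @[n --> \oo] --> (0 : R).
Proof.
move=> v0; have e1 : `|expR (- (v / 2)) : R| < 1.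
  by rewrite ger0_norm ?expR_ge0// expR_lt1; lra.
(* Since [n <= n^2], a geometric sequence dominates. *)
apply: (@squeeze_cvgr _ _ _ _ (cst 0) (fun n => expR (- (v / 2)) ^+ n)).
- apply: nearW => n; rewrite gauss_exp_ge0 /= -expRM_natl ler_expR.
  case: n => [|n]; first by rewrite expr0n/= mulr0 mul0r oppr0 mul0r.
  have : 1 <= n.+1%:R :> R by rewrite ler1n.
  move: (n.+1%:R) => u u1; have : 0 <= v * (u * (u - 1)) by rewrite !mulr_ge0; lra.
  lra.
- exact: cvg_cst.
- exact: cvg_expr.
Qed.

Lemma cos_gauss_exp_le v x t : `|cos (t * x) * gauss_exp v t| <= gauss_exp v t.
Proof. by rewrite normrM (ger0_norm (gauss_exp_ge0 _ _)) ler_piMl ?gauss_exp_ge0// cos_max. Qed.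

Lemma measurable_cosM x : measurable_fun setT (fun t : R => cos (t * x)).
Proof.
apply: continuous_measurable_fun.
by apply: derivable_continuous => t; exact: ex_derive.
Qed.

Lemma is_derive_gauss_exp v t : is_derive t 1 (gauss_exp v) (- (v * t) * gauss_exp v t).
Proof.
by rewrite /gauss_exp; apply: is_derive_eq; rewrite /GRing.scale /=; field.
Qed.

Lemma integrable_cos_gauss_exp v x : 0 < v ->
  mu.-integrable setT (EFin \o (fun t => cos (t * x) * gauss_exp v t)).
Proof.
move=> v0; apply: (dominated_integrable _ _ (integrable_gauss_exp v0)) => //.
- apply: measurable_funM; first exact: measurable_cosM.
  by have /continuous_measurable_fun := @continuous_gauss_exp v.
- by move=> t _; exact: cos_gauss_exp_le.
Qed.

Lemma sin_gauss_exp_le v x t : `|t * sin (t * x) * gauss_exp v t| <= `|t| * gauss_exp v t.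
Proof.
rewrite !normrM (ger0_norm (gauss_exp_ge0 _ _)) ler_wpM2r ?gauss_exp_ge0//.
by rewrite ler_piMr ?sin_max.
Qed.

Lemma continuous_sin_gauss_exp v x : continuous (fun t : R => t * sin (t * x) * gauss_exp v t).
Proof.
apply: continuous_funM (@continuous_gauss_exp v).
by apply: derivable_continuous => t; exact: ex_derive.
Qed.

Lemma continuous_cos_gauss_exp v x : continuous (fun t : R => cos (t * x) * gauss_exp v t).
Proof.
apply: continuous_funM (@continuous_gauss_exp v).
by apply: derivable_continuous => t; exact: ex_derive.
Qed.

Lemma integrable_sin_gauss_exp v x : 0 < v ->
  mu.-integrable setT (EFin \o (fun t => t * sin (t * x) * gauss_exp v t)).
Proof.
move=> v0; apply: (dominated_integrable _ _ (integrable_norm_gauss_exp v0)) => //.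
- by have /continuous_measurable_fun := @continuous_sin_gauss_exp v x.
- by move=> t _; exact: sin_gauss_exp_le.
Qed.

(** Integration by parts: the difference of the two integrands is the derivative of
    [sin (t * x) * gauss_exp v t], which vanishes at infinity. *)
Lemma gauss_exp_transform_parts v x : 0 < v ->
  v * \int[mu]_t (t * sin (t * x) * gauss_exp v t) =
  x * \int[mu]_t (cos (t * x) * gauss_exp v t).
Proof.
move=> v0; have ic := integrable_cos_gauss_exp x v0; have is_ := integrable_sin_gauss_exp x v0.
apply/esym/eqP; rewrite -subr_eq0 -!RintegralZl// -RintegralB//; last 2 first.
- exact: (integrableZl measurableT x ic).
- exact: (integrableZl measurableT v is_).
apply/eqP; apply: (@Rintegral_derive_eq0 (fun t => sin (t * x) * gauss_exp v t)).
- move=> t; have := is_derive_gauss_exp v t => ?.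
  by apply: is_derive_eq; rewrite /GRing.scale /=; ring.
- apply: continuous_funB; (apply: continuous_funM => [?|]; first exact: cvg_cst).
    exact: continuous_cos_gauss_exp.
  exact: continuous_sin_gauss_exp.
- have := integrableB measurableT (integrableZl measurableT x ic)
    (integrableZl measurableT v is_).
  by apply: eq_integrable.
- apply: norm_cvg0; apply: (@squeeze_cvgr _ _ _ _ (cst 0) (fun n => gauss_exp v n%:R)).
  + apply: nearW => n /=; rewrite normr_ge0/= normrM (ger0_norm (gauss_exp_ge0 _ _)).
    by rewrite ler_piMl ?gauss_exp_ge0// sin_max.
  + exact: cvg_cst.
  + exact: cvg_gauss_exp0.
- apply: norm_cvg0; apply: (@squeeze_cvgr _ _ _ _ (cst 0) (fun n => gauss_exp v n%:R)).
  + apply: nearW => n /=; rewrite normr_ge0/= normrM (ger0_norm (gauss_exp_ge0 _ _)).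
    by rewrite [in leRHS]/gauss_exp -sqrrN ler_piMl ?expR_ge0// sin_max.
  + exact: cvg_cst.
  + exact: cvg_gauss_exp0.
Qed.

Lemma is_derive_gauss_exp_transform v x : 0 < v ->
  is_derive x 1 (fun x => \int[mu]_t (cos (t * x) * gauss_exp v t))
    (- \int[mu]_t (t * sin (t * x) * gauss_exp v t)).
Proof.
move=> v0; pose f := fun x t : R => cos (t * x) * gauss_exp v t.
have df z t : is_derive z (1 : R) (f ^~ t) (- (t * sin (t * z) * gauss_exp v t)).
  by apply: is_derive_eq; rewrite /GRing.scale /=; ring.
have Ix : `]x - 1, x + 1[%classic x by rewrite /= in_itv /=; apply/andP; split; lra.
have d1 z t : partial1of2 f z t = - (t * sin (t * z) * gauss_exp v t).
  by rewrite partial1of2E; exact: derive_val.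
have int_f z : `]x - 1, x + 1[%classic z -> mu.-integrable setT (EFin \o f z).
  by move=> _; exact: integrable_cos_gauss_exp.
have der_f z t : `]x - 1, x + 1[%classic z -> setT t -> derivable (f ^~ t) z 1.
  by move=> _ _; have := df z t => -[].
have G0 t : 0 <= `|t| * gauss_exp v t by rewrite mulr_ge0 ?gauss_exp_ge0.
have Gub z t : `]x - 1, x + 1[%classic z -> setT t ->
    `|partial1of2 f z t| <= `|t| * gauss_exp v t.
  by move=> _ _; rewrite d1 normrN sin_gauss_exp_le.
have iG := integrable_norm_gauss_exp v0.
have := derivable_under_integral measurableT Ix int_f der_f G0 iG Gub.
move=> dF; apply: (DeriveDef dF); rewrite -derive1E.
rewrite (differentiation_under_integral measurableT Ix int_f der_f G0 iG Gub).
under eq_Rintegral do rewrite d1 -mulN1r.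
by rewrite RintegralZl ?mulN1r//; exact: integrable_sin_gauss_exp.
Qed.

(** The transform [F] solves [v F' = - x F], by differentiation under the integral and integration
    by parts. Hence [F x * exp (x^2 / (2 v))] is constant, and its value at 0 is the Gaussian
    integral. *)
Lemma gauss_exp_transform v x : 0 < v ->
  \int[mu]_t (cos (t * x) * gauss_exp v t) =
  Num.sqrt (2 * pi / v) * expR (- (x ^+ 2 / (2 * v))).
Proof.
move=> v0; pose F x := \int[mu]_t (cos (t * x) * gauss_exp v t).
have dFE z : is_derive z (1 : R) (fun x => F x * expR (x ^+ 2 / (2 * v))) 0.
  have dF := is_derive_gauss_exp_transform z v0.
  apply: is_derive_eq; rewrite /GRing.scale /= -/(F z).
  move: (\int[mu]_t (t * sin (t * z) * gauss_exp v t))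
    (gauss_exp_transform_parts z v0) => S /=.
  rewrite -/(F z) => /(canRL (mulKf _)) ->; last by rewrite gt_eqF.
  by field; rewrite gt_eqF.
have := is_derive_0_is_cst x 0 dFE.
rewrite expr0n/= mul0r expR0 mulr1 /F.
under [X in _ = X -> _]eq_Rintegral do rewrite mulr0 cos0 mul1r.
rewrite Rintegral_gauss_exp// expRN => <-.
by rewrite mulfK// gt_eqF ?expR_gt0.
Qed.

End GaussianTransform.

(** * Iterated means over the unit cube *)

Section CubeMean.
Context {R : realType}.
Implicit Types (f g q phi : R -> R) (a b t u x y z e M : R).

Local Notation I := (`[(- 2^-1 : R), 2^-1[%classic).

Lemma Rintegral_unit_cst e : \int[mu]_(u in I) e = e.
Proof.
rewrite Rintegral_cst//.
have := @lebesgue_measure_itv R `[- 2^-1, 2^-1[; rewrite /= lte_fin.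
have -> : (- 2^-1 < 2^-1 :> R) by lra.
by move=> -> /=; rewrite -[RHS]mulr1; congr (_ * _); lra.
Qed.

Lemma integrable_unit_cst e : mu.-integrable I (EFin \o cst e).
Proof. by apply: integrable_continuous_itv_co => x; exact: cvg_cst. Qed.

(** The base point [x] makes recursion on the dimension possible: fixing one coordinate only shifts
    it. The box spline distribution is the value at 0. *)
Definition cube_mean n (Xi : 'rV[R]_n) f x :=
  cube_integral (fun u : 'cV[R]_n => f (x + (Xi *m u) 0 0)).

Lemma cube_mean0 (Xi : 'rV[R]_0) f x : cube_mean Xi f x = f x.
Proof. by rewrite /cube_mean /= mulmx0 mxE addr0. Qed.

Lemma cube_meanS n (Xi : 'rV[R]_n.+1) f x : cube_mean Xi f x =
  \int[mu]_(t in I) cube_mean (@rsubmx _ 1 1 n Xi) f (x + Xi 0 0 * t).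
Proof.
rewrite /cube_mean /=; apply: eq_Rintegral => t _; congr cube_integral.
apply/funext => u; congr f; rewrite -addrA; congr (_ + _).
have -> : Xi *m (col_mx t%:M u : 'cV_(1 + n)) =
    @lsubmx _ 1 1 n Xi *m t%:M + @rsubmx _ 1 1 n Xi *m u.
  by rewrite -mul_row_col hsubmxK.
rewrite mxE; congr (_ + _).
rewrite mxE big_ord1 !mxE eqxx mulr1n; congr (Xi _ _ * _).
exact/val_inj.
Qed.

Lemma box_spline_distributionE n (Xi : 'rV[R]_n) f :
  box_spline_distribution Xi f = cube_mean Xi f 0.
Proof.
rewrite /box_spline_distribution /cube_mean; congr cube_integral.
by apply/funext => u; rewrite add0r.
Qed.

Lemma continuous_affine a x : continuous (fun u : R => x + a * u).
Proof. by apply: derivable_continuous => u; exact: ex_derive. Qed.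

Lemma continuous_unit_mean f a M : continuous f -> (forall x, `|f x| <= M) ->
  continuous (fun x => \int[mu]_(u in I) f (x + a * u)).
Proof.
move=> cf fM; apply: (continuous_Rintegral _ (integrable_unit_cst M)) => //.
- move=> x; apply: measurable_funTS; apply: continuous_measurable_fun.
  exact: (continuous_fun_comp cf (@continuous_affine a x)).
- move=> y _; apply: (continuous_fun_comp cf) => //.
  by apply: derivable_continuous => u; exact: ex_derive.
Qed.

(** The bound is the dominating function that makes the next one-dimensional mean continuous, so
    both properties go through a single induction. *)
Lemma cube_mean_bounded_continuous n (Xi : 'rV[R]_n) f M :
  continuous f -> (forall x, `|f x| <= M) ->
  continuous (cube_mean Xi f) /\ (forall x, `|cube_mean Xi f x| <= M).
Proof.
move=> cf fM; elim: n Xi => [|n IH] Xi.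
  have -> : cube_mean Xi f = f by apply/funext => x; exact: cube_mean0.
  by [].
have [c b] := IH (@rsubmx _ 1 1 n Xi).
have -> : cube_mean Xi f = (fun x => \int[mu]_(t in I)
    cube_mean (@rsubmx _ 1 1 n Xi) f (x + Xi 0 0 * t)).
  by apply/funext => x; exact: cube_meanS.
split; first exact: continuous_unit_mean c b.
move=> x; rewrite -[leRHS]Rintegral_unit_cst.
apply: le_norm_Rintegral => //; last exact: integrable_unit_cst.
apply: measurable_funTS; apply: continuous_measurable_fun.
exact: (continuous_fun_comp c (@continuous_affine _ x)).
Qed.

Lemma cube_mean_dist n (Xi : 'rV[R]_n) f g M N e x :
  continuous f -> (forall x, `|f x| <= M) ->
  continuous g -> (forall x, `|g x| <= N) ->
  (forall x, `|f x - g x| <= e) ->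
  `|cube_mean Xi f x - cube_mean Xi g x| <= e.
Proof.
move=> cf fM cg gN fg; elim: n Xi x => [|n IH] Xi x; first by rewrite !cube_mean0.
have [c1 _] := cube_mean_bounded_continuous (@rsubmx _ 1 1 n Xi) cf fM.
have [c2 _] := cube_mean_bounded_continuous (@rsubmx _ 1 1 n Xi) cg gN.
have c1' := continuous_fun_comp c1 (@continuous_affine (Xi 0 0) x).
have c2' := continuous_fun_comp c2 (@continuous_affine (Xi 0 0) x).
rewrite !cube_meanS -RintegralB//; [|exact: integrable_continuous_itv_co..].
rewrite -[leRHS]Rintegral_unit_cst.
apply: le_norm_Rintegral => //; last exact: integrable_unit_cst.
apply: measurable_funTS; apply: continuous_measurable_fun.
exact: continuous_funB.
Qed.

(** At [a * t / 2] this is the characteristic function, at [t], of the uniform law on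
    [[- a / 2, a / 2)]. *)
Definition sinc x : R := if x == 0 then 1 else sin x / x.

(** The waves [cos (t z)] are eigenfunctions of averaging over a symmetric interval, the sine part
    of the addition formula cancelling. Through this identity iterated means become products of
    symbols. *)
Lemma unit_mean_cos t z a :
  \int[mu]_(u in I) cos (t * (z + a * u)) = sinc (a * t / 2) * cos (t * z).
Proof.
have cc : continuous (fun u : R => cos (t * (z + a * u))).
  by apply: derivable_continuous => u; exact: ex_derive.
rewrite /sinc; case: eqP => [/eqP at0|/eqP at0].
  rewrite mul1r -[RHS]Rintegral_unit_cst.
  apply: eq_Rintegral => u _; congr cos.
  have at0' : a * t = 0 by move: at0; rewrite mulf_eq0 invr_eq0 pnatr_eq0 orbF => /eqP.
  by rewrite mulrDr mulrA (mulrC t a) at0' mul0r addr0.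
have /andP[a0 t0] : (a != 0) && (t != 0).
  by rewrite -negb_or -mulf_eq0; apply: contra at0 => /eqP ->; rewrite mul0r.
rewrite Rintegral_itv_bndo_bndc; last exact: integrable_continuous_itv_co.
have dF u : is_derive u (1 : R) (fun u => sin (t * (z + a * u)) / (a * t))
    (cos (t * (z + a * u))).
  apply: is_derive_eq; rewrite /GRing.scale /=; field.
  by rewrite ?a0 ?t0.
have cF := derivable_continuous (fun u => @ex_derive _ _ _ _ _ _ _ (dF u)).
rewrite /Rintegral (@continuous_FTC2 _ _ (fun u => sin (t * (z + a * u)) / (a * t)))/=.
- have -> : t * (z + a * 2^-1) = t * z + a * t / 2 by ring.
  have -> : t * (z + a * - 2^-1) = t * z - a * t / 2 by ring.
  by rewrite sinD sinB; field; rewrite ?a0 ?t0.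
- lra.
- exact: continuous_subspaceT.
- split => //.
  + by apply: cvg_at_right_filter; exact: cF.
  + by apply: cvg_at_left_filter; exact: cF.
- by move=> u _; rewrite derive1E; exact: derive_val.
Qed.

Lemma sincE b : sinc (b / 2) = \int[mu]_(u in I) cos (b * u).
Proof.
have := unit_mean_cos 1 0 b; rewrite mulr1 mulr0 cos0 mulr1 => <-.
by apply: eq_Rintegral => u _; rewrite mul1r add0r.
Qed.

(* The integral representation avoids the removable singularity at 0. *)
Lemma continuous_sinc : continuous sinc.
Proof.
have -> : sinc = (fun x => \int[mu]_(u in I) cos (x * 2 * u)).
  by apply/funext => x; rewrite -sincE mulfK ?pnatr_eq0.
apply: (continuous_Rintegral _ (integrable_unit_cst 1)) => //.
- move=> x; apply: measurable_funTS; apply: continuous_measurable_fun.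
  by apply: derivable_continuous => u; exact: ex_derive.
- by move=> *; exact: cos_max.
- by move=> y _; apply: derivable_continuous => u; exact: ex_derive.
Qed.

Lemma sinc_le1 x : `|sinc x| <= 1.
Proof.
have -> : x = x * 2 / 2 by field.
rewrite sincE -[leRHS]Rintegral_unit_cst.
apply: le_norm_Rintegral => //; first last.
- by move=> u _; exact: cos_max.
- exact: integrable_unit_cst.
apply: measurable_funTS; apply: continuous_measurable_fun.
by apply: derivable_continuous => u; exact: ex_derive.
Qed.

(** For an even symbol [q] this is its Fourier integral. *)
Definition ctransf q z := \int[mu]_t (cos (t * z) * q t).

Lemma cos_le q t z : `|cos (t * z) * q t| <= `|q t|.
Proof. by rewrite normrM ler_piMl// cos_max. Qed.

Lemma measurable_cos_mul q z : measurable_fun setT q ->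
  measurable_fun setT (fun t : R => cos (t * z) * q t).
Proof.
by move=> mq; apply: measurable_funM => //; exact: measurable_cosM.
Qed.

Lemma continuous_ctransf q : measurable_fun setT q ->
  mu.-integrable setT (EFin \o q) -> continuous (ctransf q).
Proof.
move=> mq iq; apply: (continuous_Rintegral _ (integrable_norm iq)) => //.
- by move=> z; exact: measurable_cos_mul.
- by move=> z t _; exact: cos_le.
- move=> t _; apply: continuous_funM => [|z]; last exact: cvg_cst.
  by apply: derivable_continuous => u; exact: ex_derive.
Qed.

Lemma ctransf_le q z : measurable_fun setT q ->
  mu.-integrable setT (EFin \o q) -> `|ctransf q z| <= \int[mu]_t `|q t|.
Proof.
move=> mq iq; apply: le_norm_Rintegral => //.
- exact: measurable_cos_mul.
- exact: (integrable_norm iq).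
- by move=> t _; exact: cos_le.
Qed.

Lemma unit_mean_ctransf q a z : measurable_fun setT q ->
  mu.-integrable setT (EFin \o q) ->
  \int[mu]_(u in I) ctransf q (z + a * u) =
  ctransf (fun t => sinc (a * t / 2) * q t) z.
Proof.
move=> mq iq.
pose f (w : R * R) := cos (w.2 * (z + a * w.1)) * q w.2.
have mf : measurable_fun setT f.
  apply: measurable_funM; last exact: (measurableT_comp mq measurable_snd).
  apply: (measurableT_comp (continuous_measurable_fun (@continuous_cos R))).
  apply: measurable_funM => //; apply: measurable_funD => //.
  exact: measurable_funM.
have -> : \int[mu]_(u in I) ctransf q (z + a * u) =
    \int[mu]_(u in I) \int[mu]_(t in setT) f (u, t) by [].
rewrite (Rintegral_swap _ _ mf (integrable_unit_cst 1) (integrable_norm iq))//.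
  apply: eq_Rintegral => t _; rewrite /f /=.
  rewrite RintegralZr//; first by rewrite unit_mean_cos; ring.
  by apply: integrable_continuous_itv_co; apply: derivable_continuous => u; exact: ex_derive.
by move=> u t _ _; rewrite mul1r cos_le.
Qed.

(** The convolution of [phi] with the function of symbol [q]. Only the second factor is described by
    its frequencies, so no transform of [phi] has to be controlled. *)
Definition ctransf_conv phi q x := \int[mu]_y (phi y * ctransf q (x - y)).

Lemma continuous_ctransf_conv phi q :
  measurable_fun setT phi -> mu.-integrable setT (EFin \o phi) ->
  measurable_fun setT q -> mu.-integrable setT (EFin \o q) ->
  continuous (ctransf_conv phi q).
Proof.
move=> mphi iphi mq iq; have cq := continuous_ctransf mq iq.
have cxy x : continuous (fun y => x - y).
  by apply: derivable_continuous => u; exact: ex_derive.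
apply: (continuous_Rintegral _
  (integrableZr measurableT (\int[mu]_t `|q t|) (integrable_norm iphi))) => //.
- move=> x; apply: measurable_funM => //; apply: continuous_measurable_fun.
  exact: continuous_fun_comp cq (cxy x).
- by move=> x y _; rewrite normrM ler_wpM2l// ctransf_le.
- move=> y _; apply: continuous_funM => [u|]; first exact: cvg_cst.
  apply: (continuous_fun_comp cq).
  by apply: derivable_continuous => u; exact: ex_derive.
Qed.

Lemma integrable_ctransf_conv phi q x :
  mu.-integrable setT (EFin \o phi) -> measurable_fun setT phi ->
  measurable_fun setT q -> mu.-integrable setT (EFin \o q) ->
  mu.-integrable setT (EFin \o (fun y => phi y * ctransf q (x - y))).
Proof.
move=> iphi mphi mq iq; have cq := continuous_ctransf mq iq.
apply: (dominated_integrable _ _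
  (integrableZr measurableT (\int[mu]_t `|q t|) (integrable_norm iphi))) => //.
- apply: measurable_funM => //; apply: continuous_measurable_fun.
  apply: (continuous_fun_comp cq).
  by apply: derivable_continuous => u; exact: ex_derive.
- by move=> y _; rewrite normrM ler_wpM2l// ctransf_le.
Qed.

Lemma ctransf_conv_le phi q x :
  measurable_fun setT phi -> mu.-integrable setT (EFin \o phi) ->
  measurable_fun setT q -> mu.-integrable setT (EFin \o q) ->
  `|ctransf_conv phi q x| <= (\int[mu]_y `|phi y|) * (\int[mu]_t `|q t|).
Proof.
move=> mphi iphi mq iq; rewrite -RintegralZr//; last exact: (integrable_norm iphi).
have := integrable_ctransf_conv x iphi mphi mq iq.
move=> /measurable_int/measurable_EFinP mpq.
apply: le_norm_Rintegral => //.
- exact: (integrableZr measurableT _ (integrable_norm iphi)).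
- by move=> y _; rewrite normrM ler_wpM2l// ctransf_le.
Qed.

Lemma ctransf_convB phi q1 q2 x :
  measurable_fun setT phi -> mu.-integrable setT (EFin \o phi) ->
  measurable_fun setT q1 -> mu.-integrable setT (EFin \o q1) ->
  measurable_fun setT q2 -> mu.-integrable setT (EFin \o q2) ->
  ctransf_conv phi q1 x - ctransf_conv phi q2 x =
  ctransf_conv phi (fun t => q1 t - q2 t) x.
Proof.
move=> mphi iphi mq1 iq1 mq2 iq2.
rewrite /ctransf_conv -RintegralB//; [|exact: integrable_ctransf_conv..].
apply: eq_Rintegral => y _; rewrite -mulrBr; congr (_ * _).
have ic q : measurable_fun setT q -> mu.-integrable setT (EFin \o q) ->
    mu.-integrable setT (EFin \o (fun t => cos (t * (x - y)) * q t)).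
  move=> mq iq; apply: (dominated_integrable _ _ (integrable_norm iq)) => //.
  - exact: measurable_cos_mul.
  - by move=> t _; exact: cos_le.
rewrite /ctransf -RintegralB//; [|exact: ic..].
by apply: eq_Rintegral => t _; rewrite -mulrBr.
Qed.

Lemma unit_mean_ctransf_conv phi q a x :
  measurable_fun setT phi -> mu.-integrable setT (EFin \o phi) ->
  measurable_fun setT q -> mu.-integrable setT (EFin \o q) ->
  \int[mu]_(u in I) ctransf_conv phi q (x + a * u) =
  ctransf_conv phi (fun t => sinc (a * t / 2) * q t) x.
Proof.
move=> mphi iphi mq iq.
pose f (w : R * R) := phi w.2 * ctransf q (x + a * w.1 - w.2).
have cq := continuous_ctransf mq iq.
have mf : measurable_fun setT f.
  apply: measurable_funM; first exact: (measurableT_comp mphi measurable_snd).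
  apply: (measurableT_comp (continuous_measurable_fun cq)).
  apply: measurable_funB => //; apply: measurable_funD => //.
  exact: measurable_funM.
have -> : \int[mu]_(u in I) ctransf_conv phi q (x + a * u) =
    \int[mu]_(u in I) \int[mu]_(y in setT) f (u, y) by [].
rewrite (Rintegral_swap _ _ mf (integrable_unit_cst (\int[mu]_t `|q t|))
  (integrable_norm iphi))//.
  apply: eq_Rintegral => y _; rewrite /f /=.
  rewrite RintegralZl//.
    rewrite -(unit_mean_ctransf a (x - y) mq iq); congr (_ * _).
    by apply: eq_Rintegral => u _; congr (ctransf q _); ring.
  apply: integrable_continuous_itv_co; apply: (continuous_fun_comp cq).
  by apply: derivable_continuous => u; exact: ex_derive.
by move=> u y _ _; rewrite /f normrM mulrC ler_wpM2r// ctransf_le.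
Qed.

Lemma measurable_sinc_scale a : measurable_fun setT (fun t => sinc (a * t / 2)).
Proof.
apply: continuous_measurable_fun; apply: (continuous_fun_comp continuous_sinc).
by apply: derivable_continuous => u; exact: ex_derive.
Qed.

Definition sinc_prod n (Xi : 'rV[R]_n) t := \prod_(j < n) sinc (Xi 0 j * t / 2).

Lemma measurable_sinc_prod n (Xi : 'rV[R]_n) : measurable_fun setT (sinc_prod Xi).
Proof. by apply: measurable_prod => j _; exact: measurable_sinc_scale. Qed.

Lemma sinc_prod_le1 n (Xi : 'rV[R]_n) t : `|sinc_prod Xi t| <= 1.
Proof.
rewrite /sinc_prod normr_prod; apply: prodr_ile1 => j _.
by rewrite normr_ge0 sinc_le1.
Qed.

(** Each coordinate of the cube contributes one [sinc] multiplier, so the iterated integral becomes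
    a single integral against a product symbol. *)
Lemma cube_mean_ctransf_conv n (Xi : 'rV[R]_n) phi q x :
  measurable_fun setT phi -> mu.-integrable setT (EFin \o phi) ->
  measurable_fun setT q -> mu.-integrable setT (EFin \o q) ->
  cube_mean Xi (ctransf_conv phi q) x =
  ctransf_conv phi (fun t => sinc_prod Xi t * q t) x.
Proof.
move=> mphi iphi mq iq; elim: n Xi x => [|n IH] Xi x.
  rewrite cube_mean0; congr (ctransf_conv phi _ x).
  by apply/funext => t; rewrite /sinc_prod big_ord0 mul1r.
have mq' : measurable_fun setT (fun t => sinc_prod (@rsubmx _ 1 1 n Xi) t * q t).
  by apply: measurable_funM => //; exact: measurable_sinc_prod.
(* The induction hypothesis needs an integrable symbol at every stage; multiplication by [sinc]
   factors, bounded by 1, preserves this. *)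
have iq' : mu.-integrable setT
    (EFin \o (fun t => sinc_prod (@rsubmx _ 1 1 n Xi) t * q t)).
  apply: (dominated_integrable _ mq' (integrable_norm iq)) => //.
  by move=> t _; rewrite normrM ler_piMl// sinc_prod_le1.
rewrite cube_meanS; under eq_Rintegral do rewrite IH.
rewrite (unit_mean_ctransf_conv _ _ mphi iphi mq' iq').
congr (ctransf_conv phi _ x); apply/funext => t; rewrite mulrA; congr (_ * _).
rewrite /sinc_prod big_ord_recl; congr (_ * _).
apply: eq_bigr => j _; rewrite mxE; congr (sinc (Xi _ _ * _ / _)).
exact/val_inj.
Qed.
End CubeMean.

(** * Smooth bump functions *)

Section Bump.
Context {R : realType}.
Implicit Types (p : {poly R}) (c d x y h s C : R).

Lemma is_derive0_quadratic (f : R -> R) x C :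
  (forall h, `|h| <= 1 -> `|f (h + x) - f x| <= C * h ^+ 2) ->
  is_derive x (1 : R) f 0.
Proof.
move=> fC.
have cvg0 : h^-1 *: (f (h + x) - f x) @[h --> 0^'] --> (0 : R).
  apply: norm_cvg0.
  apply: (@squeeze_cvgr _ _ _ _ (cst 0) (fun h : R => C * `|h|)).
  - near=> h; rewrite normr_ge0 /= /GRing.scale /= normrM normfV.
    have h0 : h != 0 by near: h; exact: nbhs_dnbhs_neq.
    rewrite mulrC ler_pdivrMr ?normr_gt0// -mulrA -expr2 real_normK ?num_real//.
    apply: fC; near: h; apply: nbhs_dnbhs.
    have := @nbhs0_le _ R^o 1 ltr01; exact.
  - exact: cvg_cst.
  - rewrite -[X in _ --> X](mulr0 C); apply: cvgM; first exact: cvg_cst.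
    rewrite -[X in _ --> X](normr0 R); apply: cvg_norm; exact: nbhs_dnbhs.
apply: DeriveDef; last by apply/cvg_lim => //; under eq_fun do rewrite scaler1.
by apply/cvg_ex; exists 0; under eq_fun do rewrite scaler1.
Unshelve. all: by end_near. Qed.

(** With [u = s^-1] this is [u^(n+2) / (n+2)! <= exp u]. The two extra powers give the quadratic
    vanishing that [is_derive0_quadratic] asks for at the edge of the window. *)
Lemma flat_le n s : 0 < s ->
  s^-1 ^+ n * expR (- s^-1) <= (n.+2)`!%:R * s ^+ 2.
Proof.
move=> s0; have sV : 0 < s^-1 by rewrite invr_gt0.
rewrite expRN ler_pdivrMr ?expR_gt0// mulrAC -ler_pdivrMr ?exprn_gt0//.
have f0 : 0 < (n.+2)`!%:R :> R by rewrite ltr0n fact_gt0.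
rewrite -exprVn -exprD addn2 mulrC -ler_pdivrMr//.
by apply: le_trans (expR_ge1Dxn n.+1 (ltW sV)); rewrite lerDr.
Qed.

Lemma is_derive_horner_exp p n (V : R -> R) x (dV : R) : is_derive x (1 : R) V dV ->
  is_derive x (1 : R) (fun y => p.[y] * (V y ^+ n * expR (- V y)))
    (p^`().[x] * (V x ^+ n * expR (- V x)) +
     p.[x] * (n%:R * V x ^+ n.-1 * dV * expR (- V x) - V x ^+ n * expR (- V x) * dV)).
Proof.
move=> HV.
have dE := @is_derive1_comp _ expR (- V) x _ _ (is_derive_expR _) (is_deriveN HV).
have -> : (fun y => p.[y] * (V y ^+ n * expR (- V y))) =
    horner p * (V ^+ n * (expR \o (- V))) by apply/funext => y; rewrite !fctE.
apply: (@is_derive_eq _ _ _ _ _ _ _ _ (is_deriveM (is_derive_poly p x)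
  (is_deriveM (is_deriveX n HV) dE))).
rewrite !fctE /GRing.scale /=. ring.
Qed.

Section Window.
Variables c d : R.
Hypothesis d0 : 0 < d.

Let W : {poly R} := (d ^+ 2)%:P - ('X - c%:P) ^+ 2.

Let WE x : W.[x] = d ^+ 2 - (x - c) ^+ 2.
Proof. by rewrite /W !hornerE. Qed.

Let in_window x : 0 < d ^+ 2 - (x - c) ^+ 2 -> x \in `[c - d, c + d].
Proof.
move: d0 => d0' W0; rewrite in_itv /= -ler_distlC distrC.
by rewrite -ler_sqr ?nnegrE ?(ltW d0')// real_normK ?num_real//; lra.
Qed.

(* The functions [p / W^n * exp (- 1 / W)], extended by 0, are closed under
   derivation. *)
Let flat p n x := if 0 < W.[x] then p.[x] * (W.[x]^-1 ^+ n * expR (- W.[x]^-1)) else 0.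

Let flat_bound p n : exists2 C, 0 <= C &
  forall x, `|flat p n x| <= C * (Num.max 0 W.[x]) ^+ 2.
Proof.
(* Outside the window [flat] is 0, so the maximum of [|p|] over the closed window suffices. *)
have [||z _ zP] := @EVT_max R (fun x => `|p.[x]|) (c - d) (c + d).
- by move: d0; lra.
- apply: continuous_subspaceT => x.
  by apply: cvg_norm; exact: continuous_horner.
exists (`|p.[z]| * (n.+2)`!%:R) => [|x]; first by rewrite mulr_ge0.
rewrite /flat; case: ltP => [W0|_]; last first.
  by rewrite normr0 mulr_ge0// ?sqr_ge0// mulr_ge0.
rewrite normrM -mulrA ler_pM//.
  by apply: zP; apply: in_window; rewrite -WE.
rewrite ger0_norm ?flat_le// mulr_ge0 ?expR_ge0// exprn_ge0// invr_ge0 ltW//.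
Qed.

(** The numerator of the derivative over [W^(n+2)]: the three terms come from differentiating [p],
    [W^-n] and [exp (- 1 / W)]. *)
Let dflat p n := p^`() * W ^+ 2 - n%:R *: (p * W^`() * W) + p * W^`().

Let dflatE p n x : (dflat p n).[x] = p^`().[x] * W.[x] ^+ 2 -
  n%:R * (p.[x] * W^`().[x] * W.[x]) + p.[x] * W^`().[x].
Proof. by rewrite /dflat; move: W => V; rewrite !hornerE; ring. Qed.

Let is_derive_flat p n x : is_derive x (1 : R) (flat p n) (flat (dflat p n) n.+2 x).
Proof.
have [W0|W0] := ltP 0 W.[x].
  have cW : continuous (horner W) by exact: continuous_horner.
  apply: (@near_eq_is_derive _ _ _
    (fun x => p.[x] * (W.[x]^-1 ^+ n * expR (- W.[x]^-1)))).
    near=> y; rewrite /flat ifT//; near: y.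
    exact: (cvgr_gt _ (cW x)).
  have dV : is_derive x (1 : R) (fun y => W.[y]^-1) (- W.[x] ^- 2 *: W^`().[x]).
    by apply: is_deriveV; rewrite gt_eqF.
  rewrite /flat W0; apply: (@is_derive_eq _ _ _ _ _ _ _ _ (is_derive_horner_exp p n dV)).
  rewrite dflatE /GRing.scale.
  move: W.[x] W0 W^`().[x] => w w0 w' /=.
  (* At [n = 0] the truncated exponent is harmless, because the factor [n%:R] vanishes. *)
  have -> : n%:R * w^-1 ^+ n.-1 = n%:R * w^-1 ^+ n * w.
    by case: n => [|n]; rewrite ?mul0r// exprSr mulrA mulfVK// gt_eqF.
  rewrite (exprD _ 2 n : w^-1 ^+ n.+2 = _).
  move: (w^-1 ^+ n) (expR _) => z e; field; exact: lt0r_neq0.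
have fx : flat p n x = 0 by rewrite /flat ltNge W0.
have -> : flat (dflat p n) n.+2 x = 0 by rewrite /flat ltNge W0.
have [C C0 flatC] := flat_bound p n.
(* As [W.[x] <= 0], the positive part of [W.[h + x]] is at most the increment of [W], which is
   [- (2 (x - c) + h) h]. For [|h| <= 1] this is at most [D * |h|], so [flat] is quadratically small
   near [x]. *)
pose D := 2 * `|x - c| + 1.
apply: (@is_derive0_quadratic _ _ (C * D ^+ 2)) => h h1.
rewrite fx subr0 (le_trans (flatC _))// -mulrA ler_wpM2l//.
rewrite -(real_normK (num_real h)) -exprMn.
rewrite ler_sqr ?nnegrE ?mulr_ge0 ?addr_ge0 ?mulr_ge0//; last first.
  by rewrite le_max lexx.
rewrite ge_max mulr_ge0 ?addr_ge0 ?mulr_ge0//=.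
apply: (@le_trans _ _ (W.[h + x] - W.[x])); first by lra.
rewrite !WE /D; apply: le_trans (ler_norm _) _.
have -> : d ^+ 2 - (h + x - c) ^+ 2 - (d ^+ 2 - (x - c) ^+ 2) =
  (- (2 * (x - c) + h)) * h by ring.
rewrite normrM normrN ler_wpM2r//.
by rewrite (le_trans (ler_normD _ _))// lerD// normrM ger0_norm.
Unshelve. all: by end_near. Qed.

Definition bump x : R := if 0 < d ^+ 2 - (x - c) ^+ 2
  then expR (- (d ^+ 2 - (x - c) ^+ 2)^-1) else 0.

Let bumpE : bump = flat 1 0.
Proof. by apply/funext => x; rewrite /bump -WE /flat -polyC1 hornerC expr0 !mul1r. Qed.

Let derive1n_flat n p m : exists q k, derive1n n (flat p m) = flat q k.
Proof.
elim: n => [|n [q [k IH]]]; first by exists p, m.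
exists (dflat q k), k.+2; rewrite derive1nS IH; apply/funext => x.
by rewrite derive1E; exact: derive_val.
Qed.

Lemma bump_smooth : smooth bump.
Proof.
move=> n x; have [q [k]] := derive1n_flat n 1 0; rewrite -bumpE => ->.
by have := is_derive_flat q k x => -[].
Qed.

Lemma continuous_bump : continuous bump.
Proof. by apply: derivable_continuous => x; exact: (@bump_smooth 0%N x). Qed.

Lemma bump_ge0 x : 0 <= bump x.
Proof. by rewrite /bump; case: ifP => // _; exact: expR_ge0. Qed.

Lemma bump_out x : ~ `[c - d, c + d]%classic x -> bump x = 0.
Proof.
move=> xcd; by rewrite /bump ifF//; apply/negP => /in_window.
Qed.

Lemma bump_test_function : test_function bump.
Proof.
split; first exact: bump_smooth.
apply: (subclosed_compact _ (@segment_compact _ (c - d) (c + d))).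
  exact: closed_closure.
have /closure_id -> : closed `[c - d, c + d]%classic by exact: interval_closed.
apply: closure_subset => x /= bx.
by apply: contrapT => /bump_out; apply/eqP.
Qed.

Lemma bump_le1 x : bump x <= 1.
Proof.
rewrite /bump; case: ifP => // W0; rewrite -expR0 ler_expR oppr_le0 invr_ge0.
exact: ltW.
Qed.

(** The derivative is again of the form [flat], hence bounded: the positive part of [W] never
    exceeds [d^2]. The constant controls the error of mollification. *)
Lemma bump_lipschitz : exists2 L, 0 <= L &
  forall x y, `|bump x - bump y| <= L * `|x - y|.
Proof.
have [C C0 CP] := flat_bound (dflat 1 0) 2.
have dle x : `|flat (dflat 1 0) 2 x| <= C * (d ^+ 2) ^+ 2.
  rewrite (le_trans (CP x))// ler_wpM2l// ler_sqr ?nnegrE ?sqr_ge0 ?le_max ?lexx//.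
  by rewrite ge_max sqr_ge0 WE lerBlDr lerDl sqr_ge0.
exists (C * (d ^+ 2) ^+ 2) => [|x y]; first by rewrite mulr_ge0// sqr_ge0.
wlog xy : x y / y <= x.
  by move=> H; have [/H//|/ltW/H] := leP y x; rewrite distrC (distrC y).
have [||z _ ->] := @MVT_segment _ bump (flat (dflat 1 0) 2) y x xy.
- by move=> z _; rewrite bumpE; exact: is_derive_flat.
- exact/continuous_subspaceT/continuous_bump.
by rewrite normrM ler_wpM2r.
Qed.

Lemma integrable_bump : mu.-integrable setT (EFin \o bump).
Proof.
have -> : EFin \o bump = (EFin \o bump) \_ `[c - d, c + d].
  apply/funext => x; rewrite patchE; case: ifPn => // /negP xcd /=.
  by rewrite bump_out// => /mem_set.
apply/(integrable_mkcond _ _).1 => //.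
exact: (integrable_continuous_segment (c - d) (c + d) continuous_bump).
Qed.

Lemma Rintegral_bump_gt0 : 0 < \int[mu]_x bump x.
Proof.
have d0' := d0; pose J := `[c - d / 2, c + d / 2]%classic.
(* On the half window [|x - c| <= d / 2] one has [W >= 3 d^2 / 4], so [m] bounds the bump from below
   there. *)
pose m : R := expR (- (3 / 4 * d ^+ 2)^-1).
have iJ : mu.-integrable setT (EFin \o ((cst m : R -> R) \_ J)).
  rewrite -restrict_EFin; apply/(integrable_mkcond _ _).1; first exact: measurable_itv.
  by apply: (@integrable_continuous_segment _ _ _ (cst m)) => x; exact: cvg_cst.
apply: (@lt_le_trans _ _ (\int[mu]_x ((cst m : R -> R) \_ J) x)).
  rewrite -Rintegral_mkcond Rintegral_cst; last exact: measurable_itv.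
  have := @lebesgue_measure_itv R `[c - d / 2, c + d / 2]; rewrite /= lte_fin.
  have -> : c - d / 2 < c + d / 2 by lra.
  by move=> -> /=; rewrite mulr_gt0 ?expR_gt0//; lra.
apply: (le_Rintegral measurableT iJ integrable_bump).
move=> x _; rewrite patchE; case: ifPn => [/set_mem|_]; last exact: bump_ge0.
rewrite /J /= in_itv /= => /andP[x1 x2].
have q : 3 / 4 * d ^+ 2 <= d ^+ 2 - (x - c) ^+ 2 by nra.
have d2 : 0 < 3 / 4 * d ^+ 2 by rewrite mulr_gt0// ?exprn_gt0//; lra.
rewrite /bump (lt_le_trans d2 q) /m ler_expR lerN2 lef_pV2// posrE//.
exact: lt_le_trans d2 q.
Qed.

End Window.
End Bump.

(** * From symbols to densities *)

Section Transfer.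
Context {R : realType}.
Implicit Types (f g q phi B : R -> R) (c d s t v x y z eta : R).

Lemma ler_add_vanishing (X A b c : R) : 0 <= b -> 0 <= c ->
  (forall e, 0 < e -> X <= A + e ^+ 2 * b + e * c) -> X <= A.
Proof.
move=> b0 c0 H; apply/ler_addgt0Pr => e e0.
(* Since [r <= 1], the quadratic error is at most [r * b]; the summand 1 keeps the denominator
   positive. *)
pose r := Num.min 1 (e / (b + c + 1)).
have r0 : 0 < r by rewrite lt_min ltr01 divr_gt0//; lra.
apply: (le_trans (H _ r0)); rewrite -addrA lerD2l.
have r1 : r <= 1 by rewrite ge_min lexx.
have re : r * (b + c + 1) <= e.
  by rewrite -ler_pdivlMr ?ge_min ?lexx ?orbT//; lra.
have : 0 <= r * (1 - r) * b by rewrite !mulr_ge0//; lra.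
nra.
Qed.

(** The factor [(2 * pi)^-1] makes [heat v] the normal density of variance [v]. *)
Definition heat_symbol v t : R := (2 * pi)^-1 * gauss_exp v t.

Definition heat v := ctransf (heat_symbol v).

Lemma measurable_heat_symbol v : measurable_fun setT (heat_symbol v).
Proof.
apply: measurable_funM => //.
by have /continuous_measurable_fun := @continuous_gauss_exp R v.
Qed.

Lemma integrable_heat_symbol v : 0 < v -> mu.-integrable setT (EFin \o heat_symbol v).
Proof. by move=> v0; exact: (integrableZl measurableT _ (integrable_gauss_exp v0)). Qed.

Lemma heatE v z : 0 < v ->
  heat v z = (Num.sqrt (2 * pi * v))^-1 * expR (- (z ^+ 2 / (2 * v))).
Proof.
move=> v0; have pi0 := pi_gt0 R; have p2 : 0 < 2 * pi :> R by lra.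
rewrite /heat /ctransf /heat_symbol; under eq_Rintegral do rewrite mulrCA.
rewrite RintegralZl//; last exact: integrable_cos_gauss_exp.
rewrite gauss_exp_transform// mulrA; congr (_ * _).
move: (@pi R) pi0 p2 => p pi0 p2.
have -> : 2 * p / v = (2 * p) ^+ 2 / (2 * p * v).
  by field; rewrite !lt0r_neq0.
rewrite sqrtrM ?sqr_ge0// sqrtr_sqr ger0_norm ?ltW// sqrtrV ?mulr_ge0 ?ltW//.
by rewrite mulKf// gt_eqF.
Qed.

Lemma heatN v z : heat v (- z) = heat v z.
Proof. by apply: eq_Rintegral => t _; rewrite mulrN cosN. Qed.

Lemma heat_normal s x y : 0 < s -> heat s (x - y) = normal_pdf x (Num.sqrt s) y.
Proof.
move=> s0; rewrite heatE// normal_pdfE ?gt_eqF ?sqrtr_gt0//.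
rewrite /normal_peak /normal_fun sqr_sqrtr ?ltW//; congr ((Num.sqrt _)^-1 * expR _).
  by rewrite -mulr_natr; ring.
by rewrite -mulr_natr; field; exact: lt0r_neq0.
Qed.

Lemma heat_ge0 s z : 0 < s -> 0 <= heat s z.
Proof. by move=> s0; rewrite heatE// mulr_ge0 ?expR_ge0// invr_ge0. Qed.

Lemma integrable_heat s x : 0 < s -> mu.-integrable setT (EFin \o (fun y => heat s (x - y))).
Proof.
move=> s0; have := integrable_normal_pdf x (Num.sqrt s).
by apply: eq_integrable => // y _; rewrite /= heat_normal.
Qed.

Lemma Rintegral_heat s x : 0 < s -> \int[mu]_y heat s (x - y) = 1.
Proof.
move=> s0; under eq_Rintegral do rewrite heat_normal//.
by rewrite /Rintegral integral_normal_pdf.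
Qed.

(** This is [norm_gauss_exp_le] at [s^-1]. Halving the exponent doubles the variance, so the right
    side is a multiple of a probability density and the first absolute moment of [heat s] is at most
    [sqrt (2 s)]. *)
Lemma norm_heat_le s z : 0 < s ->
  `|z| * heat s z <= Num.sqrt s * Num.sqrt 2 * heat (2 * s) z.
Proof.
move=> s0; have pi0 := pi_gt0 R; rewrite !heatE; [|lra..].
have sV : 0 < s^-1 by rewrite invr_gt0.
have := norm_gauss_exp_le z sV; rewrite invrK /gauss_exp.
have -> : s^-1 * z ^+ 2 / 2 = z ^+ 2 / (2 * s) by field; exact: lt0r_neq0.
have -> : s^-1 / 2 * z ^+ 2 / 2 = z ^+ 2 / (2 * (2 * s)) by field; exact: lt0r_neq0.
move=> H; rewrite mulrCA.
have -> : 2 * pi * (2 * s) = 2 * (2 * pi * s) by ring.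
rewrite (sqrtrM (2 * pi * s)) // (invfM (Num.sqrt 2)).
have r2 : Num.sqrt 2 != 0 :> R by rewrite gt_eqF// sqrtr_gt0; lra.
have -> : forall a b e : R, a * Num.sqrt 2 * ((Num.sqrt 2)^-1 * b * e) = b * (a * e).
  by move=> a b e; field.
by rewrite ler_wpM2l// invr_ge0.
Qed.

Lemma heat_mollify phi L s x : 0 < s -> measurable_fun setT phi ->
  mu.-integrable setT (EFin \o (fun y => phi y * heat s (x - y))) ->
  (forall y z, `|phi y - phi z| <= L * `|y - z|) ->
  `|phi x - ctransf_conv phi (heat_symbol s) x| <= L * (Num.sqrt s * Num.sqrt 2).
Proof.
move=> s0 mphi ic Lip.
have mh : measurable_fun setT (fun y => heat s (x - y)).
  have := continuous_ctransf (measurable_heat_symbol s) (integrable_heat_symbol s0).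
  move=> ch; apply: continuous_measurable_fun; apply: (continuous_fun_comp ch).
  by apply: derivable_continuous => u; exact: ex_derive.
have s20 : 0 < 2 * s by lra.
have -> : phi x = \int[mu]_y (phi x * heat s (x - y)).
  by rewrite RintegralZl ?Rintegral_heat ?mulr1//; exact: integrable_heat.
rewrite -RintegralB//; last first.
  exact: (integrableZl measurableT (phi x) (integrable_heat x s0)).
have ih := integrableZl measurableT (L * (Num.sqrt s * Num.sqrt 2)) (integrable_heat x s20).
have -> : L * (Num.sqrt s * Num.sqrt 2) =
    \int[mu]_y (L * (Num.sqrt s * Num.sqrt 2) * heat (2 * s) (x - y)).
  by rewrite RintegralZl ?Rintegral_heat ?mulr1//; exact: integrable_heat.
apply: le_norm_Rintegral => //.
  by apply: measurable_funB; apply: measurable_funM.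
move=> y _; rewrite -mulrBl normrM (ger0_norm (heat_ge0 _ s0)).
apply: (@le_trans _ _ (L * (`|x - y| * heat s (x - y)))).
  by rewrite mulrA ler_wpM2r ?heat_ge0.
rewrite -mulrA ler_wpM2l ?norm_heat_le//.
by have := le_trans (normr_ge0 _) (Lip 1 0); rewrite subr0 normr1 mulr1.
Qed.

(** Its value is [1 / 2]; only its being a fixed number matters. *)
Definition transfer_cst : R := (2 * pi)^-1 * \int[mu]_t (1 + t ^+ 2)^-1.

(** Only the box spline symbol carries the regularising factor. The mismatch [1 - gauss_exp s t] is
    at most [s t^2 / 2], and [gauss_exp v] keeps it integrable. *)
Lemma mul_gauss_exp_dist_le (u h : R) s v t : 0 < s -> `|u - gauss_exp v t| <= h ->
  `|u * gauss_exp s t - gauss_exp v t| <= h + s * (t ^+ 2 * gauss_exp v t).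
Proof.
move=> s0 uh; have g0 := gauss_exp_ge0 v t; have st : 0 <= s * t ^+ 2.
  by rewrite mulr_ge0 ?sqr_ge0 ?(ltW s0).
have gk1 : gauss_exp s t <= 1 by rewrite expR_le1 oppr_le0 divr_ge0.
have -> : u * gauss_exp s t - gauss_exp v t =
    (u - gauss_exp v t) * gauss_exp s t - gauss_exp v t * (1 - gauss_exp s t) by ring.
apply: le_trans (ler_normB _ _) _; apply: lerD.
  by rewrite normrM (ger0_norm (gauss_exp_ge0 _ _)) (le_trans _ uh)// ler_piMr.
have g1 : 0 <= 1 - gauss_exp s t by rewrite subr_ge0.
rewrite (ger0_norm (mulr_ge0 g0 g1)) mulrA mulrC; apply: ler_wpM2r => //.
have : 1 + - (s * t ^+ 2 / 2) <= gauss_exp s t by exact: expR_ge1Dx.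
by move: (gauss_exp s t) (s * t ^+ 2) st => a b; lra.
Qed.

Lemma ctransf_conv_heat_dist phi n (Xi : 'rV[R]_n) v s eta :
  measurable_fun setT phi -> mu.-integrable setT (EFin \o phi) ->
  (forall y, 0 <= phi y) -> 0 < s -> 0 < v ->
  (forall t, `|sinc_prod Xi t - gauss_exp v t| <= eta * (1 + t ^+ 2)^-1) ->
  `|ctransf_conv phi (fun t => sinc_prod Xi t * heat_symbol s t) 0 -
    ctransf_conv phi (heat_symbol v) 0| <=
  (\int[mu]_y phi y) * ((2 * pi)^-1 *
    (eta * (\int[mu]_t (1 + t ^+ 2)^-1) + s * \int[mu]_t (t ^+ 2 * gauss_exp v t))).
Proof.
move=> mphi iphi phi0 s0 v0 symb.
have N0 : 0 <= (2 * pi)^-1 :> R by rewrite invr_ge0 mulr_ge0 ?pi_ge0.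
have mhs := measurable_heat_symbol s; have ihs := integrable_heat_symbol s0.
have mhv := measurable_heat_symbol v; have ihv := integrable_heat_symbol v0.
set q := fun t => sinc_prod Xi t * heat_symbol s t.
have mq : measurable_fun setT q.
  by apply: measurable_funM => //; exact: measurable_sinc_prod.
have iq : mu.-integrable setT (EFin \o q).
  apply: (dominated_integrable _ mq (integrable_norm ihs)) => //.
  by move=> t _; rewrite normrM ler_piMl// sinc_prod_le1.
pose g t := (2 * pi)^-1 * (eta * (1 + t ^+ 2)^-1 + s * (t ^+ 2 * gauss_exp v t)).
have i0 := @integrable_oneDsqrV R; have i0' := integrable_sqr_gauss_exp v0.
have i1 := integrableZl measurableT eta i0.
have i2 := integrableZl measurableT s i0'.
have i12 := integrableD measurableT i1 i2.
have ig : mu.-integrable setT (EFin \o g) by exact: (integrableZl measurableT _ i12).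
have qg t : `|q t - heat_symbol v t| <= g t.
  rewrite /q /heat_symbol mulrCA -mulrBr normrM (ger0_norm N0).
  by apply: (ler_wpM2l N0); exact: mul_gauss_exp_dist_le s0 (symb t).
have mqv : measurable_fun setT (fun t => q t - heat_symbol v t) by exact: measurable_funB.
have iqv := dominated_integrable measurableT mqv ig (fun t _ => qg t).
rewrite (ctransf_convB _ mphi iphi mq iq mhv ihv).
apply: le_trans (ctransf_conv_le _ mphi iphi mqv iqv) _.
have -> : \int[mu]_y `|phi y| = \int[mu]_y phi y.
  by apply: eq_Rintegral => y _; rewrite ger0_norm.
apply: ler_wpM2l; first by apply: Rintegral_ge0 => y _; exact: phi0.
rewrite -(RintegralZl eta measurableT i0) -(RintegralZl s measurableT i0').
rewrite -(RintegralD measurableT i1 i2) -(RintegralZl _ measurableT i12).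
apply: (le_Rintegral measurableT (integrable_norm iqv) ig) => t _.
exact: qg.
Qed.

Lemma cube_mean_bump_heat n (Xi : 'rV[R]_n) v eta c d : 0 < d -> 0 < v -> 0 <= eta ->
  (forall t, `|sinc_prod Xi t - gauss_exp v t| <= eta * (1 + t ^+ 2)^-1) ->
  `|cube_mean Xi (bump c d) 0 - \int[mu]_y (bump c d y * heat v y)|
  <= transfer_cst * eta * \int[mu]_y bump c d y.
Proof.
move=> d0 v0 eta0 symb; set phi := bump c d.
have cphi : continuous phi by exact: continuous_bump.
have mphi : measurable_fun setT phi by exact: continuous_measurable_fun.
have iphi : mu.-integrable setT (EFin \o phi) by exact: integrable_bump.
have phi1 y : `|phi y| <= 1 by rewrite ger0_norm ?bump_ge0 ?bump_le1.
have [L L0 Lip] := bump_lipschitz c d0.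
pose M2 := \int[mu]_t (t ^+ 2 * gauss_exp v t).
have M20 : 0 <= M2 by apply: Rintegral_ge0 => t _; rewrite mulr_ge0 ?sqr_ge0 ?gauss_exp_ge0.
have Phi0 : 0 <= \int[mu]_y phi y by apply: Rintegral_ge0 => y _; exact: bump_ge0.
have N0 : 0 <= (2 * pi)^-1 :> R by rewrite invr_ge0 mulr_ge0 ?pi_ge0.
apply: (@ler_add_vanishing _ _ ((2 * pi)^-1 * M2 * \int[mu]_y phi y) (L * Num.sqrt 2)).
- by rewrite !mulr_ge0.
- by rewrite mulr_ge0.
(* With variance [e^2] the mollification error, of the order of the standard deviation, is linear in
   [e], and the error on the symbols is quadratic. *)
move=> e e0; have s0 : 0 < e ^+ 2 by rewrite exprn_gt0.
set s := e ^+ 2 in s0 *.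
have mhs := measurable_heat_symbol s; have ihs := integrable_heat_symbol s0.
have mhv := measurable_heat_symbol v; have ihv := integrable_heat_symbol v0.
pose psi := ctransf_conv phi (heat_symbol s).
have step1 : `|cube_mean Xi phi 0 - cube_mean Xi psi 0| <= e * (L * Num.sqrt 2).
  rewrite mulrCA; have -> : e = Num.sqrt s by rewrite sqrtr_sqr ger0_norm// ltW.
  apply: (@cube_mean_dist _ _ _ _ _ 1
    ((\int[mu]_y `|phi y|) * (\int[mu]_t `|heat_symbol s t|))) => //.
  - exact: continuous_ctransf_conv.
  - by move=> x; exact: ctransf_conv_le.
  - move=> x; apply: heat_mollify => //.
    exact: (integrable_ctransf_conv x iphi mphi mhs ihs).
have step2 : cube_mean Xi psi 0 =
    ctransf_conv phi (fun t => sinc_prod Xi t * heat_symbol s t) 0.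
  exact: cube_mean_ctransf_conv.
(* The kernel is even, so pairing with it is convolution evaluated at 0. *)
have step3 : \int[mu]_y (phi y * heat v y) = ctransf_conv phi (heat_symbol v) 0.
  by apply: eq_Rintegral => y _; rewrite sub0r -/(heat v _) heatN.
have step4 := ctransf_conv_heat_dist mphi iphi (@bump_ge0 R c d) s0 v0 symb.
rewrite step3; apply: le_trans (ler_distD (cube_mean Xi psi 0) _ _) _.
rewrite step2 in step1 *; apply: le_trans (lerD step1 step4) _.
rewrite /transfer_cst /M2 le_eqVlt; apply/orP; left; apply/eqP; ring.
Qed.

Lemma continuous_heat v : 0 < v -> continuous (heat v).
Proof.
by move=> v0; apply: continuous_ctransf;
  [exact: measurable_heat_symbol|exact: integrable_heat_symbol].
Qed.

Lemma integrable_mul_bump f c d : 0 < d -> continuous f ->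
  mu.-integrable setT (EFin \o (fun y => f y * bump c d y)).
Proof.
move=> d0 cf.
have -> : EFin \o (fun y => f y * bump c d y) =
    (EFin \o (fun y => f y * bump c d y)) \_ `[c - d, c + d].
  apply/funext => y; rewrite patchE; case: ifPn => // /negP yJ /=.
  by rewrite bump_out ?mulr0// => /mem_set.
apply/(integrable_mkcond _ _).1; first exact: measurable_itv.
apply: integrable_continuous_segment; apply: continuous_funM => //.
exact: continuous_bump.
Qed.

(** An excess of [f - g] over [A] at [x] would persist nearby by continuity; a bump supported there,
    having positive integral, would contradict the hypothesis. *)
Lemma le_of_bump_integrals f g A x : continuous f -> continuous g ->
  (forall d, 0 < d -> \int[mu]_y (f y * bump x d y) - \int[mu]_y (g y * bump x d y)
     <= A * \int[mu]_y bump x d y) ->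
  f x - g x <= A.
Proof.
move=> cf cg H; rewrite leNgt; apply/negP => lt.
pose A' := (A + (f x - g x)) / 2.
have AA' : A < A' by rewrite /A'; lra.
have : \forall y \near x, A' < f y - g y.
  have cfg := continuous_funB cf cg.
  apply: (cvgr_gt _ (cfg x)); rewrite /A'; lra.
move=> /nbhs_ballP[r /= r0 rP]; pose d := r / 2.
have d0 : 0 < d by rewrite /d; lra.
have I0 := Rintegral_bump_gt0 x d0.
have := H _ d0; rewrite leNgt => /negP; apply.
have ib := integrable_bump x d0.
have if_ := integrable_mul_bump x d0 cf; have ig := integrable_mul_bump x d0 cg.
apply: (@lt_le_trans _ _ (A' * \int[mu]_y bump x d y)); first by rewrite ltr_pM2r.
rewrite -RintegralB// -RintegralZl//.
apply: le_Rintegral => //.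
- exact: (integrableZl measurableT A' ib).
- have := integrableB measurableT if_ ig.
  by apply: eq_integrable.
move=> y _; rewrite -mulrBl.
have [/= yJ|/bump_out ->//] := pselect (`[x - d, x + d]%classic y); last by rewrite !mulr0.
rewrite ler_wpM2r ?bump_ge0// ltW//; apply: rP.
move: yJ; rewrite in_itv /= -ler_distlC /ball /= distrC => /le_lt_trans; apply.
by rewrite /d; lra.
Qed.

Lemma box_spline_heat n (Xi : 'rV[R]_n) B v eta x : is_box_spline Xi B -> continuous B ->
  0 < v -> 0 <= eta ->
  (forall t, `|sinc_prod Xi t - gauss_exp v t| <= eta * (1 + t ^+ 2)^-1) ->
  `|heat v x - B x| <= transfer_cst * eta.
Proof.
move=> [_ boxB] cB v0 eta0 symb; have ch := continuous_heat v0.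
have key d : 0 < d -> `|\int[mu]_y (B y * bump x d y) -
    \int[mu]_y (heat v y * bump x d y)|
    <= transfer_cst * eta * \int[mu]_y bump x d y.
  move=> d0; rewrite (boxB _ (bump_test_function x d0)) box_spline_distributionE.
  under [X in _ - X]eq_Rintegral do rewrite mulrC.
  exact: cube_mean_bump_heat.
rewrite ler_norml; apply/andP; split.
  rewrite lerNl opprB; apply: (le_of_bump_integrals cB ch) => d d0.
  exact: le_trans (ler_norm _) (key d d0).
apply: (le_of_bump_integrals ch cB) => d d0.
by apply: le_trans (key d d0); rewrite distrC ler_norm.
Qed.

End Transfer.

(** * Estimates on the sinc function *)

Section Estimates.
Context {R : realType}.
Implicit Types (a b t v w x y z p : R).

(** Starting from [cos <= 1], repeated use gives the alternating Taylor bounds, each one being the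
    derivative inequality for the next. *)
Lemma ge0_of_derive_ge0 (f df : R -> R) : (forall x, is_derive x 1 f (df x)) ->
  f 0 = 0 -> (forall x, 0 <= x -> 0 <= df x) -> forall x, 0 <= x -> 0 <= f x.
Proof.
move=> fdf f0 df0 x x0.
have cf : continuous f.
  by apply: derivable_continuous => y; have := fdf y => -[].
have [|z] := @MVT_segment _ f df 0 x x0 (fun y _ => fdf y).
  exact: continuous_subspaceT.
rewrite in_itv /= f0 !subr0 => /andP[z0 _] ->.
by rewrite mulr_ge0// df0.
Qed.

Lemma sin_le_id x : 0 <= x -> sin x <= x.
Proof.
move=> x0; rewrite -subr_ge0.
apply: (@ge0_of_derive_ge0 (fun y => y - sin y) (fun y => 1 - cos y) _ _ _ x x0).
- by rewrite sin0 subr0.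
- by move=> y _; rewrite subr_ge0 cos_le1.
Qed.

Lemma cos_ge_taylor2 x : 0 <= x -> 1 - x ^+ 2 / 2 <= cos x.
Proof.
move=> x0; rewrite -subr_ge0.
apply: (@ge0_of_derive_ge0 (fun y => cos y - (1 - y ^+ 2 / 2)) (fun y => y - sin y) _ _ _ x x0).
- by move=> y; apply: is_derive_eq; rewrite /GRing.scale /=; field.
- by rewrite cos0; ring.
- by move=> y y0; rewrite subr_ge0 sin_le_id.
Qed.

Lemma sin_ge_taylor3 x : 0 <= x -> x - x ^+ 3 / 6 <= sin x.
Proof.
move=> x0; rewrite -subr_ge0.
apply: (@ge0_of_derive_ge0 (fun y => sin y - (y - y ^+ 3 / 6))
  (fun y => cos y - (1 - y ^+ 2 / 2)) _ _ _ x x0).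
- by move=> y; apply: is_derive_eq; rewrite /GRing.scale /=; field.
- by rewrite sin0; ring.
- by move=> y y0; rewrite subr_ge0 cos_ge_taylor2.
Qed.

Lemma cos_le_taylor4 x : 0 <= x -> cos x <= 1 - x ^+ 2 / 2 + x ^+ 4 / 24.
Proof.
move=> x0; rewrite -subr_ge0.
apply: (@ge0_of_derive_ge0 (fun y => 1 - y ^+ 2 / 2 + y ^+ 4 / 24 - cos y)
  (fun y => sin y - (y - y ^+ 3 / 6)) _ _ _ x x0).
- by move=> y; apply: is_derive_eq; rewrite /GRing.scale /=; field.
- by rewrite cos0; ring.
- by move=> y y0; rewrite subr_ge0 sin_ge_taylor3.
Qed.

Lemma sin_le_taylor5 x : 0 <= x -> sin x <= x - x ^+ 3 / 6 + x ^+ 5 / 120.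
Proof.
move=> x0; rewrite -subr_ge0.
apply: (@ge0_of_derive_ge0 (fun y => y - y ^+ 3 / 6 + y ^+ 5 / 120 - sin y)
  (fun y => 1 - y ^+ 2 / 2 + y ^+ 4 / 24 - cos y) _ _ _ x x0).
- by move=> y; apply: is_derive_eq; rewrite /GRing.scale /=; field.
- by rewrite sin0; ring.
- by move=> y y0; rewrite subr_ge0 cos_le_taylor4.
Qed.

Lemma expRN_le_taylor2 x : 0 <= x -> expR (- x) <= 1 - x + x ^+ 2 / 2.
Proof.
move=> x0; rewrite -subr_ge0.
apply: (@ge0_of_derive_ge0 (fun y => 1 - y + y ^+ 2 / 2 - expR (- y))
  (fun y => expR (- y) - (1 - y)) _ _ _ x x0).
- by move=> y; apply: is_derive_eq; rewrite /GRing.scale /=; field.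
- by rewrite oppr0 expR0; ring.
- by move=> y y0; rewrite subr_ge0 expR_ge1Dx.
Qed.

Lemma sincN x : sinc (- x) = sinc x.
Proof. by rewrite /sinc oppr_eq0 sinN invrN mulrNN. Qed.

Lemma sinc_bounds x : 1 - x ^+ 2 / 6 <= sinc x <= 1 - x ^+ 2 / 6 + x ^+ 4 / 120.
Proof.
wlog x0 : x / 0 <= x.
  move=> H; have [/H//|/ltW x0] := leP 0 x.
  by rewrite -sincN -sqrrN (_ : x ^+ 4 = (- x) ^+ 4) ?H ?oppr_ge0//; ring.
rewrite /sinc; case: eqP => [->|/eqP xn0]; first by apply/andP; split; lra.
have {xn0}x0 : 0 < x by rewrite lt_neqAle eq_sym xn0.
have x0' := ltW x0; rewrite ler_pdivlMr// ler_pdivrMr//.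
have := sin_ge_taylor3 x0'; have := sin_le_taylor5 x0'.
by move=> h1 h2; apply/andP; split; [apply: le_trans h2|apply: (le_trans h1)]; lra.
Qed.

Lemma sinc_sqr_le x : sinc x ^+ 2 * (1 + x ^+ 2 / 6) <= 1.
Proof.
have /andP[l u] := sinc_bounds x.
(* With [y = x^2], the bound [sin^2 <= 1] suffices when [1 / y + 1 / 6 <= 1], that is from
   [y = 6 / 5] on. Below, the Taylor bound gives [0 <= sinc x <= 1 - 3 y / 20]. *)
have [x2|x2] := leP (6 / 5) (x ^+ 2).
  have : sinc x ^+ 2 * x ^+ 2 <= 1.
    rewrite -exprMn /sinc; case: eqP => [x0|/eqP x0].
      by move: x2; rewrite x0 expr0n /=; lra.
    by rewrite divfK// -[leRHS](cos2Dsin2 x) lerDr sqr_ge0.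
  have := sqr_ge0 (sinc x); move: (sinc x ^+ 2) (x ^+ 2) x2 => S y y65 S0 Sy.
  nra.
have x4 : x ^+ 4 = x ^+ 2 * x ^+ 2 by ring.
rewrite x4 in u; have y0 := sqr_ge0 x.
move: (sinc x) (x ^+ 2) l u y0 x2 => S y l u y0 y65.
have u' : S <= 1 - 3 / 20 * y by nra.
have S0 : 0 <= S by lra.
have S2 : S ^+ 2 <= (1 - 3 / 20 * y) ^+ 2 by rewrite ler_sqr ?nnegrE//; lra.
have : (1 - 3 / 20 * y) ^+ 2 * (1 + y / 6) <= 1 by nra.
by apply: le_trans; rewrite ler_wpM2r//; lra.
Qed.

Lemma exp_sqr_le x : expR (- (x ^+ 2 / 6)) ^+ 2 * (1 + x ^+ 2 / 6) <= 1.
Proof.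
have z0 : 0 <= x ^+ 2 / 6 by rewrite divr_ge0 ?sqr_ge0.
move: (x ^+ 2 / 6) z0 => z z0.
have z1 : 0 <= 1 + z by rewrite addr_ge0.
rewrite expr2 -mulrA; apply: mulr_ile1; rewrite ?mulr_ge0 ?expR_ge0//.
  by rewrite expR_le1 oppr_le0.
by rewrite expRN mulrC ler_pdivrMr ?expR_gt0// mul1r expR_ge1Dx.
Qed.

(** Both functions lie above [1 - x^2 / 6], by at most [x^4 / 120] and [x^4 / 72]; the larger excess
    bounds the difference. *)
Lemma sinc_exp_le x : `|sinc x - expR (- (x ^+ 2 / 6))| <= x ^+ 4 / 72.
Proof.
have /andP[l u] := sinc_bounds x.
have z0 : 0 <= x ^+ 2 / 6 by rewrite divr_ge0 ?sqr_ge0.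
have := expRN_le_taylor2 z0; have := expR_ge1Dx (- (x ^+ 2 / 6)).
have x4 : x ^+ 4 = x ^+ 2 * x ^+ 2 by ring.
have : 0 <= x ^+ 4 by rewrite x4 mulr_ge0 ?sqr_ge0.
move=> h h1 h2; rewrite ler_norml; apply/andP; split; last lra.
have -> : x ^+ 4 / 72 = (x ^+ 2 / 6) ^+ 2 / 2 by field.
lra.
Qed.

(** Factors are exchanged one at a time; each exchange costs [D] and leaves [n - 1] factors bounded
    by [p]. *)
Lemma prod_dist_le n (f e : 'I_n -> R) p D : 0 <= D ->
  (forall j, `|f j| <= p) -> (forall j, `|e j| <= p) ->
  (forall j, `|f j - e j| <= D) ->
  `|\prod_j f j - \prod_j e j| <= n%:R * D * p ^+ n.-1.
Proof.
move=> D0; elim: n f e => [|n IH] f e fp ep fe.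
  by rewrite !big_ord0 subrr normr0 !mul0r.
have p0 : 0 <= p by exact: le_trans (fp ord0).
rewrite !big_ord_recl; set F := \prod_(i < n) _; set G := \prod_(i < n) _.
have Fp : `|F| <= p ^+ n.
  rewrite /F normr_prod -[in leRHS](card_ord n) -prodr_const.
  by apply: ler_prod => j _; rewrite normr_ge0 fp.
have FG : `|F - G| <= n%:R * D * p ^+ n.-1 by apply: IH => j.
have -> : f ord0 * F - e ord0 * G = (f ord0 - e ord0) * F + e ord0 * (F - G) by ring.
apply: le_trans (ler_normD _ _) _; rewrite !normrM.
have -> : n.+1%:R * D * p ^+ n.+1.-1 = D * p ^+ n + n%:R * D * p ^+ n.
  by rewrite -natr1 /=; ring.
apply: lerD; first by rewrite ler_pM.
have -> : n%:R * D * p ^+ n = p * (n%:R * D * p ^+ n.-1).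
  by case: n {IH F G f e fp ep fe Fp FG} => [|n] /=; rewrite ?exprS; ring.
by rewrite ler_pM.
Qed.

Definition damp w : R := (Num.sqrt (1 + w))^-1.

Lemma damp_ge0 w : 0 <= damp w. Proof. by rewrite invr_ge0. Qed.

Lemma damp_sqr w : 0 <= w -> damp w ^+ 2 = (1 + w)^-1.
Proof. by move=> w0; rewrite exprVn sqr_sqrtr// addr_ge0. Qed.

Lemma damp_le1 w : 0 <= w -> damp w <= 1.
Proof.
move=> w0; rewrite -(ler_sqr (damp_ge0 w)) ?nnegrE ?ler01// damp_sqr// expr1n.
by rewrite invf_le1 ?lerDl//; lra.
Qed.

Lemma norm_le_damp x w z : 0 <= w <= z -> x ^+ 2 * (1 + z) <= 1 -> `|x| <= damp w.
Proof.
move=> /andP[w0 wz] xz; rewrite -ler_sqr ?nnegrE ?damp_ge0// damp_sqr//.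
rewrite real_normK ?num_real// -[leRHS]mul1r ler_pdivlMr; last lra.
by apply: le_trans xz; rewrite ler_wpM2l ?sqr_ge0// lerD2l.
Qed.

Lemma bernoulli_le w n : 0 <= w -> 1 + n%:R * w <= (1 + w) ^+ n.
Proof.
move=> w0; elim: n => [|n IH]; first by rewrite mul0r addr0 expr0.
rewrite exprS -natr1.
have : 0 <= (1 + w) * ((1 + w) ^+ n - (1 + n%:R * w)).
  by rewrite mulr_ge0 ?subr_ge0//; lra.
have : 0 <= n%:R * (w * w) by rewrite !mulr_ge0.
lra.
Qed.

(** The cube is chosen so that two powers absorb the quartic remainder in [t] and one survives for
    integrability. *)
Lemma damp_exp_le w n : (12 <= n)%N -> 0 <= w ->
  damp w ^+ n.-1 <= (1 + n%:R * w / 12) ^- 3.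
Proof.
(* Six factors [damp w] make [(1 + w)^-3]. With [r] such groups Bernoulli's inequality gives
   [(1 + r w)^-3], and [r >= n / 12]. *)
move=> n12 w0; pose r := (n.-1 %/ 6)%N.
have r6 : (2 * r * 3 <= n.-1)%N by rewrite /r; lia.
have nr : (n <= 12 * r)%N by rewrite /r; lia.
apply: le_trans (ler_wiXn2l (damp_ge0 w) (damp_le1 w0) r6) _.
have w1 : 0 < 1 + n%:R * w / 12.
  by rewrite ltr_pwDl// divr_ge0// mulr_ge0.
rewrite !exprM damp_sqr// -!exprVn lerXn2r ?nnegrE ?exprn_ge0 ?invr_ge0//; [lra|lra|].
rewrite exprVn lef_pV2 ?posrE ?exprn_gt0//; last lra.
apply: le_trans (bernoulli_le r w0); rewrite lerD2l.
have : n%:R <= 12 * r%:R :> R by rewrite -natrM ler_nat.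
move=> /(ler_wpM2r w0); lra.
Qed.

Lemma oneD_sqrV_le b t : 0 < b -> (1 + b * t ^+ 2)^-1 <= (1 + b^-1) * (1 + t ^+ 2)^-1.
Proof.
move=> b0; have t0 := sqr_ge0 t; have bV : 0 < b^-1 by rewrite invr_gt0.
have bt : 0 <= b * t ^+ 2 by rewrite mulr_ge0 ?(ltW b0).
rewrite ler_pdivlMr; last by lra.
rewrite mulrC ler_pdivrMr; last by lra.
have -> : (1 + b^-1) * (1 + b * t ^+ 2) = 1 + t ^+ 2 + b^-1 + b * t ^+ 2.
  by field; exact: lt0r_neq0.
lra.
Qed.

Lemma expRN_dist_le x y z : z <= x -> z <= y ->
  `|expR (- x) - expR (- y)| <= `|x - y| * expR (- z).
Proof.
wlog xy : x y / x <= y.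
  by move=> H zx zy; have [/H|/ltW/H] := leP x y; [apply|rewrite distrC (distrC x); apply].
move=> zx zy; have -> : expR (- y) = expR (- x) * expR (- (y - x)).
  by rewrite -expRD; congr expR; ring.
rewrite -{1}[expR (- x)]mulr1 -mulrBr normrM mulrC (distrC x).
have yx : 0 <= y - x by rewrite subr_ge0.
rewrite (ger0_norm (expR_ge0 _)) (ger0_norm yx) ger0_norm; last first.
  by rewrite subr_ge0 expR_le1 oppr_le0.
apply: ler_pM; rewrite ?expR_ge0 ?subr_ge0 ?expR_le1 ?oppr_le0//.
  by have := expR_ge1Dx (- (y - x)); lra.
by rewrite ler_expR lerN2.
Qed.

(** With [z = b t^2], the claim follows from [z (1 + z) <= (1 + z)^2 <= exp (2 z)]. *)
Lemma sqr_exp_le b t : 0 < b ->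
  t ^+ 2 * expR (- (2 * b * t ^+ 2)) <= b^-1 * (1 + b * t ^+ 2)^-1.
Proof.
move=> b0; have z0 : 0 <= b * t ^+ 2 by rewrite mulr_ge0 ?sqr_ge0// ltW.
have -> : t ^+ 2 * expR (- (2 * b * t ^+ 2)) =
    b^-1 * (b * t ^+ 2 * expR (- (2 * (b * t ^+ 2)))).
  by rewrite (mulrA 2) !mulrA mulVf ?mul1r// lt0r_neq0.
rewrite ler_wpM2l ?invr_ge0 ?(ltW b0)//.
move: (b * t ^+ 2) z0 => z z0.
have z1 : 0 < 1 + z by lra.
rewrite expRN -[leRHS]mul1r ler_pdivrMr ?expR_gt0// mulrAC ler_pdivlMr// mul1r.
have -> : expR (2 * z) = expR z * expR z by rewrite -expRD; congr expR; ring.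
apply: (@le_trans _ _ ((1 + z) * (1 + z))).
  by rewrite ler_wpM2r//; lra.
by apply: ler_pM; rewrite ?expR_ge1Dx// ltW.
Qed.

End Estimates.

(** * Estimates on symbols *)

Section SymbolBounds.
Context {R : realType}.
Implicit Types (a b c t v w x y z p sigma : R).

(** The Gaussian of exactly the box spline's variance splits into one factor per entry, which gives
    each [sinc] a partner in the telescoping. *)
Lemma exp_prodE n (Xi : 'rV[R]_n) t :
  expR (- ((\sum_(j < n) Xi 0 j ^+ 2) * t ^+ 2 / 24)) =
  \prod_(j < n) expR (- ((Xi 0 j * t / 2) ^+ 2 / 6)).
Proof.
rewrite -expR_sum; congr expR; rewrite !mulr_suml -sumrN.
by apply: eq_bigr => j _; field.
Qed.

Lemma norm_factor_le a b t : 0 < a <= b ->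
  `|sinc (b * t / 2)| <= damp (a ^+ 2 * t ^+ 2 / 24) /\
  `|expR (- ((b * t / 2) ^+ 2 / 6))| <= damp (a ^+ 2 * t ^+ 2 / 24).
Proof.
move=> /andP[a0 ab].
have zw : 0 <= a ^+ 2 * t ^+ 2 / 24 <= (b * t / 2) ^+ 2 / 6.
  have -> : (b * t / 2) ^+ 2 / 6 = b ^+ 2 * t ^+ 2 / 24 by field.
  have ab2 : a ^+ 2 <= b ^+ 2 by rewrite ler_sqr ?nnegrE ?(ltW a0)//; lra.
  have := ler_wpM2r (sqr_ge0 t) ab2.
  have : 0 <= a ^+ 2 * t ^+ 2 by rewrite mulr_ge0 ?sqr_ge0.
  by move=> h1 h2; apply/andP; split; lra.
by split; [exact: norm_le_damp zw (sinc_sqr_le _)|exact: norm_le_damp zw (exp_sqr_le _)].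
Qed.

Lemma sinc_prod_gauss_le n (Xi : 'rV[R]_n) a c t : (12 <= n)%N -> 0 < a ->
  (forall j, a <= Xi 0 j <= c * a) ->
  `|sinc_prod Xi t - expR (- ((\sum_(j < n) Xi 0 j ^+ 2) * t ^+ 2 / 24))| <=
  72 * c ^+ 4 / n%:R * (1 + n%:R * a ^+ 2 / 288 * t ^+ 2)^-1.
Proof.
move=> n12 a0 aXi; pose w := a ^+ 2 * t ^+ 2 / 24.
have w0 : 0 <= w by rewrite divr_ge0// mulr_ge0 ?sqr_ge0.
have n0 : 0 < n%:R :> R by rewrite ltr0n; exact: leq_trans n12.
rewrite exp_prodE; pose D := (c * a * t / 2) ^+ 4 / 72.
have D0 : 0 <= D by rewrite divr_ge0// (_ : 4%N = (2 * 2)%N)// exprM sqr_ge0.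
apply: le_trans (@prod_dist_le R n (fun j => sinc (Xi 0 j * t / 2)) _ (damp w) D D0 _ _ _) _.
- by move=> j; have /andP[aj _] := aXi j; have [|->] := @norm_factor_le a (Xi 0 j) t;
    rewrite ?a0.
- by move=> j; have /andP[aj _] := aXi j; have [|_ ->] := @norm_factor_le a (Xi 0 j) t;
    rewrite ?a0.
- move=> j; apply: le_trans (sinc_exp_le _) _.
  have /andP[aj jc] := aXi j; rewrite /D ler_wpM2r//.
  rewrite (_ : 4%N = (2 * 2)%N)// !exprM ler_sqr ?nnegrE ?sqr_ge0//.
  have -> : (Xi 0 j * t / 2) ^+ 2 = Xi 0 j ^+ 2 * (t ^+ 2 / 4) by field.
  have -> : (c * a * t / 2) ^+ 2 = (c * a) ^+ 2 * (t ^+ 2 / 4) by field.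
  rewrite ler_wpM2r ?divr_ge0 ?sqr_ge0//.
  by rewrite ler_sqr ?nnegrE//; lra.
apply: le_trans (ler_wpM2l _ (damp_exp_le n12 w0)) _.
  by rewrite mulr_ge0// ltW.
have -> : n%:R * a ^+ 2 / 288 * t ^+ 2 = n%:R * w / 12 by rewrite /w; field.
(* The gain of [1 / n]: with [y = n w / 12], the [n] quartic remainders total a multiple of
   [y^2 / n], and [y^2 (1 + y)^-3 <= (1 + y)^-1]. *)
have -> : n%:R * D = 72 * c ^+ 4 / n%:R * (n%:R * w / 12) ^+ 2.
  by rewrite /D /w; field; exact: lt0r_neq0.
have K0 : 0 <= 72 * c ^+ 4 / n%:R.
  by rewrite divr_ge0 ?(ltW n0)// mulr_ge0// (_ : 4%N = (2 * 2)%N)// exprM sqr_ge0.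
move: (72 * c ^+ 4 / n%:R) K0 => K K0.
have : 0 <= n%:R * w / 12 by rewrite divr_ge0// mulr_ge0 ?(ltW n0).
move: (n%:R * w / 12) => y y0; have y1 : 0 < 1 + y by lra.
rewrite -mulrA ler_wpM2l//.
rewrite ler_pdivrMr ?exprn_gt0// (_ : (1 + y)^-1 * _ = (1 + y) ^+ 2).
  by rewrite ler_sqr ?nnegrE; lra.
by field; exact: lt0r_neq0.
Qed.

Lemma gauss_symbol_dist_le sigma e t : sigma != 0 -> `|e| <= sigma ^+ 2 / 2 ->
  `|expR (- ((sigma ^+ 2 + e) * t ^+ 2 / 24)) - gauss_exp (sigma ^+ 2 / 12) t| <=
  `|e| * (4 / sigma ^+ 2) * (1 + sigma ^+ 2 / 96 * t ^+ 2)^-1.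
Proof.
move=> s0 es; have s2 : 0 < sigma ^+ 2 by rewrite exprn_even_gt0.
have t0 := sqr_ge0 t; rewrite /gauss_exp.
have [e1 e2] : - (sigma ^+ 2 / 2) <= e /\ e <= sigma ^+ 2 / 2.
  by move: es; rewrite ler_norml => /andP.
have st : 0 <= sigma ^+ 2 * t ^+ 2 by rewrite mulr_ge0// ltW.
(* As [|e| <= sigma^2 / 2], both exponents are at least [sigma^2 t^2 / 48], written as twice
   [sigma^2 t^2 / 96] to match [sqr_exp_le]. *)
apply: le_trans (@expRN_dist_le R _ _ (2 * (sigma ^+ 2 / 96) * t ^+ 2) _ _) _.
- have : 0 <= (e + sigma ^+ 2 / 2) * t ^+ 2 by rewrite mulr_ge0//; lra.
  lra.
- lra.
have -> : (sigma ^+ 2 + e) * t ^+ 2 / 24 - sigma ^+ 2 / 12 * t ^+ 2 / 2 =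
  e * (t ^+ 2 / 24) by field.
have t24 : 0 <= t ^+ 2 / 24 by rewrite divr_ge0.
rewrite normrM (ger0_norm t24).
have s96 : 0 < sigma ^+ 2 / 96 by rewrite divr_gt0.
have := ler_wpM2l (normr_ge0 e) (sqr_exp_le t s96).
set E := expR _; set V := (1 + sigma ^+ 2 / 96 * t ^+ 2)^-1 => H.
have h24 : 0 <= 24^-1 :> R by rewrite invr_ge0.
have := ler_wpM2r h24 H; congr (_ <= _); first by field.
by field; rewrite ?s0.
Qed.

Lemma sinc_prod_heat_le n (Xi : 'rV[R]_n) a b c sigma e t : (12 <= n)%N -> 0 < a ->
  (forall j, a <= Xi 0 j <= c * a) -> sigma != 0 -> `|e| <= sigma ^+ 2 / 2 ->
  \sum_(j < n) Xi 0 j ^+ 2 = sigma ^+ 2 + e ->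
  b = sigma ^+ 2 / (576 * c ^+ 2) ->
  `|sinc_prod Xi t - gauss_exp (sigma ^+ 2 / 12) t| <=
  (72 * c ^+ 4 * (1 + b^-1) / n%:R +
   4 / sigma ^+ 2 * (1 + (sigma ^+ 2 / 96)^-1) * `|e|) * (1 + t ^+ 2)^-1.
Proof.
move=> n12 a0 aXi s0 es S bE; have s2 : 0 < sigma ^+ 2 by rewrite exprn_even_gt0.
have n0 : 0 < n%:R :> R by rewrite ltr0n; exact: leq_trans n12.
have c0 : 0 < c.
  case: n Xi n12 aXi {S n0} => // n Xi _ /(_ ord0)/andP[h1 h2].
  by rewrite -(pmulr_lgt0 _ a0); lra.
have c2 : 0 < c ^+ 2 by rewrite exprn_gt0.
have c576 : 0 < 576 * c ^+ 2 by apply: mulr_gt0 c2; rewrite ltr0n.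
have b0 : 0 < b by rewrite bE; exact: divr_gt0.
(* The squared norm lies between [sigma^2 / 2] and [n (c a)^2]. This bounds [n a^2] below
   independently of [n], and [576 = 2 * 288]. *)
have bn : b <= n%:R * a ^+ 2 / 288.
  have : \sum_(j < n) Xi 0 j ^+ 2 <= n%:R * (c * a) ^+ 2.
    rewrite mulr_natl -[in leRHS](card_ord n) -sumr_const.
    apply: ler_sum => j _; have /andP[h1 h2] := aXi j.
    by rewrite ler_sqr ?nnegrE//; lra.
  rewrite S exprMn => H; rewrite bE (ler_pdivrMr _ _ c576).
  have : - `|e| <= e by rewrite lerNl -normrN ler_norm.
  lra.
rewrite mulrDl; apply: le_trans (ler_distD
  (expR (- ((\sum_(j < n) Xi 0 j ^+ 2) * t ^+ 2 / 24))) _ _) _.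
apply: lerD.
  apply: le_trans (sinc_prod_gauss_le t n12 a0 aXi) _.
  have -> : 72 * c ^+ 4 * (1 + b^-1) / n%:R * (1 + t ^+ 2)^-1 =
    72 * c ^+ 4 / n%:R * ((1 + b^-1) * (1 + t ^+ 2)^-1) by ring.
  rewrite ler_wpM2l//.
    by rewrite divr_ge0 ?(ltW n0)// mulr_ge0// exprn_ge0// ltW.
  apply: le_trans (oneD_sqrV_le t b0).
  have t0 := sqr_ge0 t; have bt : 0 <= b * t ^+ 2 by rewrite mulr_ge0 ?(ltW b0).
  have := ler_wpM2r t0 bn => bnt.
  by rewrite lef_pV2 ?posrE; lra.
rewrite S; apply: le_trans (gauss_symbol_dist_le t s0 es) _.
have s96 : 0 < sigma ^+ 2 / 96 by rewrite divr_gt0.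
have := oneD_sqrV_le t s96.
set V := (_ + sigma ^+ 2 / 96 * _)^-1; set W := (1 + t ^+ 2)^-1 => H.
have h : 0 <= 4 / sigma ^+ 2 * `|e| by rewrite mulr_ge0// divr_ge0// ltW.
have := ler_wpM2l h H; congr (_ <= _); ring.
Qed.

(** Two factors of order [1 / |t|] already give [1 / (1 + t^2)]. This serves the finitely many [n]
    below the asymptotic threshold. *)
Lemma sinc_prod_heat_crude n (Xi : 'rV[R]_n) a v : (2 <= n)%N -> 0 < a -> 0 < v ->
  (forall j, a <= Xi 0 j) -> exists2 M, 0 <= M & forall t,
  `|sinc_prod Xi t - gauss_exp v t| <= M * (1 + t ^+ 2)^-1.
Proof.
move=> n2 a0 v0 aXi; have a2 : 0 < a ^+ 2 / 24 by rewrite divr_gt0// exprn_gt0.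
have v2 : 0 < v / 2 by lra.
have aV : 0 < (a ^+ 2 / 24)^-1 by rewrite invr_gt0.
have vV : 0 < (v / 2)^-1 by rewrite invr_gt0.
exists ((1 + (a ^+ 2 / 24)^-1) + (1 + (v / 2)^-1)) => [|t]; first lra.
have t0 := sqr_ge0 t.
have w0 : 0 <= a ^+ 2 * t ^+ 2 / 24 by rewrite divr_ge0// mulr_ge0// sqr_ge0.
rewrite mulrDl; apply: le_trans (ler_normB _ _) _; apply: lerD.
  apply: le_trans (oneD_sqrV_le t a2).
  have -> : (1 + a ^+ 2 / 24 * t ^+ 2)^-1 = damp (a ^+ 2 * t ^+ 2 / 24) ^+ 2.
    by rewrite damp_sqr//; congr (_^-1); ring.
  apply: le_trans (ler_wiXn2l (damp_ge0 _) (damp_le1 w0) n2).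
  rewrite /sinc_prod normr_prod -[in leRHS](card_ord n) -prodr_const.
  apply: ler_prod => j _; rewrite normr_ge0 /=.
  by have [|->] := @norm_factor_le a (Xi 0 j) t; rewrite ?a0 ?aXi.
apply: le_trans (oneD_sqrV_le t v2).
rewrite ger0_norm ?gauss_exp_ge0// /gauss_exp expRN.
have vt : 0 <= v * t ^+ 2 by rewrite mulr_ge0// ltW.
rewrite lef_pV2 ?posrE ?expR_gt0//; last lra.
by apply: le_trans (expR_ge1Dx _); lra.
Qed.

End SymbolBounds.

(** * The local limit theorem *)

Section LocalLimit.
Context {R : realType}.
Implicit Types (a c v x sigma e M : R).

Lemma gaussian_heat sigma x : sigma != 0 -> gaussian sigma x = heat (sigma ^+ 2 / 12) x.
Proof.
move=> s0; have s2 : 0 < sigma ^+ 2 by rewrite exprn_even_gt0.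
rewrite heatE ?divr_gt0// /gaussian; have pi0 := pi_gt0 R.
move: (@pi R) pi0 => p p0; rewrite -sqrtrV; last first.
  by have := mulr_ge0 (ltW p0) (ltW s2); lra.
congr (Num.sqrt _ * expR _); first by field; rewrite ?s0 ?lt0r_neq0.
by field; rewrite ?s0.
Qed.

Lemma entry_bounds n (Xi : 'rV[R]_n) c : (0 < n)%N -> (forall j, 0 < Xi 0 j) ->
  max_entry Xi / min_entry Xi <= c ->
  0 < min_entry Xi /\ forall j, min_entry Xi <= Xi 0 j <= c * min_entry Xi.
Proof.
move=> n0 Xi0; have lemax j : Xi 0 j <= max_entry Xi by exact: le_bigmax.
have min0 : 0 < min_entry Xi.
  apply: lt_bigmin => //; exact: lt_le_trans (Xi0 (Ordinal n0)) (lemax _).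
rewrite ler_pdivrMr// => maxc; split => // j; rewrite (le_trans (lemax j) maxc) andbT.
exact: bigmin_le.
Qed.

Lemma box_spline_dist_le n (Xi : 'rV[R]_n) B a b c sigma e x : (12 <= n)%N ->
  is_box_spline Xi B -> continuous B -> 0 < a ->
  (forall j, a <= Xi 0 j <= c * a) -> sigma != 0 -> `|e| <= sigma ^+ 2 / 2 ->
  \sum_(j < n) Xi 0 j ^+ 2 = sigma ^+ 2 + e ->
  b = sigma ^+ 2 / (576 * c ^+ 2) -> 0 < c ->
  `|gaussian sigma x - B x| <= transfer_cst * (72 * c ^+ 4 * (1 + b^-1) / n%:R +
   4 / sigma ^+ 2 * (1 + (sigma ^+ 2 / 96)^-1) * `|e|).
Proof.
move=> n12 boxB cB a0 aXi s0 es S bE c0; rewrite gaussian_heat//.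
have s2 : 0 < sigma ^+ 2 by rewrite exprn_even_gt0.
have c576 : 0 < 576 * c ^+ 2 by apply: mulr_gt0; [rewrite ltr0n|exact: exprn_gt0].
have b0 : 0 < b by rewrite bE; exact: divr_gt0.
apply: (box_spline_heat _ boxB cB); first by rewrite divr_gt0.
- rewrite addr_ge0// mulr_ge0//.
  + by rewrite mulr_ge0 ?mulr_ge0 ?exprn_ge0 ?addr_ge0 ?invr_ge0 ?(ltW c0) ?(ltW b0).
  + by rewrite mulr_ge0 ?divr_ge0 ?addr_ge0 ?invr_ge0 ?divr_ge0 ?(ltW s2).
- by move=> t; exact: (sinc_prod_heat_le _ n12 a0 aXi s0 es S bE).
Qed.

Lemma box_spline_dist_bounded n (Xi : 'rV[R]_n) B sigma : (2 <= n)%N ->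
  is_box_spline Xi B -> continuous B -> 0 < min_entry Xi ->
  (forall j, min_entry Xi <= Xi 0 j) -> sigma != 0 ->
  exists M, forall x, `|gaussian sigma x - B x| <= M.
Proof.
move=> n2 boxB cB a0 aXi s0.
have s2 : 0 < sigma ^+ 2 / 12 by rewrite divr_gt0// exprn_even_gt0.
have [M M0 HM] := sinc_prod_heat_crude n2 a0 s2 aXi.
exists (transfer_cst * M) => x; rewrite gaussian_heat//.
exact: (box_spline_heat x boxB cB s2 M0 HM).
Qed.

Lemma near_ln_ge M : \forall k \near \oo, M <= ln (k%:R : R).
Proof.
near=> k; have : expR M <= k%:R by near: k; exact: nbhs_infty_ger.
move=> eMk; rewrite -(expRK M) ler_ln ?posrE ?expR_gt0//.
exact: lt_le_trans (expR_gt0 _) eMk.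
Unshelve. all: by end_near. Qed.

Lemma le_rate (k : nat) e M1 M2 : 1 <= ln (k%:R : R) -> M1 <= ln k%:R -> M2 <= ln k%:R ->
  `|e| <= expR (- 1) -> M1 / k%:R + M2 * `|e| <= rate k e.
Proof.
move=> l1 lM1 lM2 e1; rewrite /rate; set l := ln k%:R in l1 lM1 lM2 *.
apply: lerD.
  rewrite ler_wpM2r ?invr_ge0//; apply: (le_trans lM1).
  by rewrite -[leLHS]expr1 ler_weXn2l.
(* At [e = 0] the logarithm is a default value, but both sides carry the factor [|e|]. *)
have [->|en0] := eqVneq e 0; first by rewrite normr0 mulr0 !mul0r.
rewrite mulrC -mulrA ler_wpM2l//.
have lne : ln `|e| <= -1 by rewrite -(expRK (-1)) ler_ln ?posrE ?expR_gt0// normr_gt0.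
have : 1 <= `|ln `|e| |.
  by rewrite ler0_norm; [lra|apply: le_trans lne _; lra].
move: (`|ln `|e| |) => u u1.
have : 0 <= l * (u - 1) by rewrite mulr_ge0; lra.
lra.
Qed.

(** At [k = 1] the rate is 0. Positivity turns a bound for one fixed [k] into a multiple of the
    rate. *)
Lemma rate_gt0 (k : nat) e : (2 <= k)%N -> 0 < rate k e.
Proof.
move=> k2; have k1 : 1 < k%:R :> R by rewrite ltr1n.
have l0 : 0 < ln (k%:R : R) by rewrite ln_gt0.
rewrite /rate ltr_pwDl//; first by rewrite divr_gt0 ?exprn_gt0//; lra.
by rewrite !mulr_ge0// ltW.
Qed.

End LocalLimit.

Theorem theorem4 (R : realType) (c1 c2 : R) (c1_gt0 : 0 < c1) (c2_gt0 : 0 < c2) :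
  exists2 C : R, 0 < C &
  forall (Xi : forall k : nat, 'rV[R]_k) (B : nat -> R -> R)
    (sigma : R) (eps : nat -> R),
  (forall k (j : 'I_k), 0 < Xi k 0 j) ->
  (forall k, (1 <= k)%N -> is_box_spline (Xi k) (B k)) ->
  (* for k >= 2, B k is the (unique) continuous representative *)
  (forall k, (2 <= k)%N -> continuous (B k)) ->
  sigma != 0 ->
  (forall k, (1 <= k)%N ->
    \sum_(j < k) Xi k 0 j ^+ 2 = sigma ^+ 2 + eps k) ->
  eps k @[k --> \oo] --> (0 : R) ->
  (forall k, (1 <= k)%N ->
    c1 <= max_entry (Xi k) / min_entry (Xi k) <= c2) ->
  (* one constant depending on c1 and c2 only, for all large k *)
  (\forall k \near \oo, forall x : R,
    `|gaussian sigma x - B k x| <= C * rate k (eps k)) /\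
  (* all k >= 2 at once, for the given data *)
  (exists C' : R, forall k, (2 <= k)%N -> forall x : R,
    `|gaussian sigma x - B k x| <= C' * rate k (eps k)).
Proof.
exists 1 => // Xi B sigma eps Xi0 boxB cB s0 S eps0 c12.
have s2 : 0 < sigma ^+ 2 by rewrite exprn_even_gt0.
pose b := sigma ^+ 2 / (576 * c2 ^+ 2).
pose M1 := transfer_cst * (72 * c2 ^+ 4 * (1 + b^-1)).
pose M2 := transfer_cst * (4 / sigma ^+ 2 * (1 + (sigma ^+ 2 / 96)^-1)).
have entries k : (1 <= k)%N -> 0 < min_entry (Xi k) /\
    forall j, min_entry (Xi k) <= Xi k 0 j <= c2 * min_entry (Xi k).
  by move=> k1; apply: entry_bounds => //; have /andP[] := c12 k k1.
have large : \forall k \near \oo, forall x : R,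
    `|gaussian sigma x - B k x| <= 1 * rate k (eps k).
  near=> k => x; have k12 : (12 <= k)%N by near: k; exact: nbhs_infty_ge.
  have k1 : (1 <= k)%N by exact: leq_trans k12.
  have [a0 aXi] := entries k k1.
  have es : `|eps k| <= sigma ^+ 2 / 2.
    by near: k; apply: cvgr0_norm_le eps0 _ _; rewrite divr_gt0.
  apply: le_trans (box_spline_dist_le x k12 (boxB k k1) (cB k (leq_trans _ k12)) a0 aXi
    s0 es (S k k1) (erefl b) c2_gt0) _ => //.
  rewrite mul1r mulrDr (mulrA transfer_cst _ (k%:R^-1)) (mulrA transfer_cst _ `|eps k|).
  apply: le_rate.
  - by near: k; exact: near_ln_ge.
  - by near: k; exact: near_ln_ge.
  - by near: k; exact: near_ln_ge.
  - by near: k; apply: cvgr0_norm_le eps0 _ _; exact: expR_gt0.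
split; first exact: large.
have [N _ HN] := large.
have /choice[M HM] k : exists M, (2 <= k)%N -> forall x, `|gaussian sigma x - B k x| <= M.
  have [k2|] := boolP (2 <= k)%N; last by exists 0.
  have [a0 aXi] := entries k (ltnW k2).
  have [M HM] := @box_spline_dist_bounded _ k (Xi k) (B k) sigma k2 (boxB k (ltnW k2))
    (cB k k2) a0 (fun j => (andP (aXi j)).1) s0.
  by exists M.
(* The summand 1 serves [k >= N]; the sum exceeds each of the finitely many ratios needed for
   smaller [k]. *)
exists (1 + \sum_(k < N) `|M k / rate k (eps k)|) => k k2 x.
have r0 := rate_gt0 (eps k) k2.
have [Nk|kN] := leqP N k.
  apply: le_trans (HN k Nk x) _; rewrite ler_pM2r// lerDl.
  exact: sumr_ge0.
apply: le_trans (HM k k2 x) _; rewrite -ler_pdivrMr//.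
apply: le_trans (ler_norm _) _.
rewrite (bigD1 (Ordinal kN))//= addrCA lerDl addr_ge0// sumr_ge0.
Unshelve. all: by end_near. Qed.
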